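(* Let $\nu\in[0,1)$. For every $t>0$, $$\mathrm{Tr}\,(e^{-t\mathcal M_\nu})=\frac{2\cosh(t\nu)}{1-e^{-t}}-e^{t\nu}=\frac{\cosh\big(t(\nu-\frac12)\big)}{\sinh(t/2)},$$ and, as $t\to0^+$, $$\mathrm{Tr}\,(e^{-t\mathcal M_\nu})=\frac2t+\Big(\frac16-\nu+\nu^2\Big)t+\mathcal O(t^3).$$
   Context: For $\nu\in\mathbb R$, $A_\nu(x,y)=\frac{\nu}{r^2}(-y,x)$, with $r^2=x^2+y^2$, is the Aharonov–Bohm potential on $\mathbb R^2\setminus\{0\}$. $\mathcal M_\nu$ is the Dirichlet-to-Neumann operator on the unit circle $S^1$ associated with the Friedrichs extension of the magnetic Laplacian $(D-A_\nu)^2$ ($D=-i\nabla$) in the unit disk $D(0,1)\subset\mathbb R^2$: for boundary data $\Psi$ on $S^1$, $\mathcal M_\nu\Psi=\partial_rv|_{r=1}$, where $(D-A_\nu)^2v=0$ in $D(0,1)\setminus\{0\}$, $v=\Psi$ on $S^1$ and $v$ is the solution whose angular Fourier modes are bounded at $0$. Its eigenvalues are $\lambda_k(\nu)=|k-\nu|$, $k\in\mathbb Z$ (counted with multiplicity, with eigenfunctions $e^{ik\theta}$), so that $\mathrm{Tr}(e^{-t\mathcal M_\nu})=\sum_{k\in\mathbb Z}e^{-t|k-\nu|}$. *)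

(* Defs.v *)
From HB Require Import structures.
From mathcomp Require Import all_boot all_order all_algebra.
From mathcomp Require Import all_classical all_reals all_analysis.
From mathcomp Require Import complex.

Set Implicit Arguments.
Unset Strict Implicit.
Unset Printing Implicit Defensive.

Import Order.TTheory GRing.Theory Num.Theory.
Import numFieldNormedType.Exports.

Local Open Scope classical_set_scope.
Local Open Scope complex_scope.
Local Open Scope ring_scope.

Definition cosh (R : realType) (x : R) : R := (expR x + expR (- x)) / 2.

Definition sinh (R : realType) (x : R) : R := (expR x - expR (- x)) / 2.

(* |z|^2, as an element of R (the norm of R[i] takes its values in R[i]) *)
Definition sqmod (R : realType) (z : R[i]) : R :=
  complex.Re z ^+ 2 + complex.Im z ^+ 2.

(** * The Hilbert space L^2(S^1)

  A function on the circle is a function of the angle, of which only the values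
  on [0, 2 pi] matter. The measure is d theta, without the factor 1/(2 pi). *)

Definition circle (R : realType) : set R := `[0, 2 * pi]%classic.

(* \int_0^{2 pi} |f|^2 d theta *)
Definition sqnormL2 (R : realType) (f : R -> R[i]) : \bar R :=
  (\int[lebesgue_measure]_(x in @circle R) (sqmod (f x))%:E)%E.

Definition in_L2 (R : realType) (f : R -> R[i]) : Prop :=
  [/\ measurable_fun (@circle R) (fun x => complex.Re (f x)),
      measurable_fun (@circle R) (fun x => complex.Im (f x))
    & (sqnormL2 f < +oo)%E].

Definition integral_circle (R : realType) (f : R -> R[i]) : R[i] :=
  Rintegral lebesgue_measure (@circle R) (fun x => complex.Re (f x)) +i*
  Rintegral lebesgue_measure (@circle R) (fun x => complex.Im (f x)).

Definition dotL2 (R : realType) (f g : R -> R[i]) : R[i] :=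
  integral_circle (fun x => f x * ((g x)^*)%C).

(* Orthonormal families of L^2(S^1) which are complete, in the form of
   Parseval's identity. Since L^2(S^1) is separable and infinite-dimensional,
   indexing by the integers loses no Hilbert basis. *)
Definition hilbert_basis (R : realType) (e : int -> R -> R[i]) : Prop :=
  [/\ forall k, in_L2 (e k),
      forall j k, dotL2 (e j) (e k) = (j == k)%:R
    & forall f, in_L2 f ->
        (\esum_(k in [set: int]) (sqmod (dotL2 f (e k)))%:E)%E = sqnormL2 f].

(** * The trace of exp (- t M)

  An unbounded operator M on L^2(S^1) is given by its graph:
  M f g means that f is in the domain of M and that M f = g. *)

Definition diagonalizes (R : realType) (M : (R -> R[i]) -> (R -> R[i]) -> Prop)
    (e : int -> R -> R[i]) (lam : int -> R) : Prop :=
  hilbert_basis e /\ forall k, M (e k) (fun x => (lam k)%:C * e k x).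

(* The quadratic form <exp (- t M) f, f>, by functional calculus for an operator
   M that is diagonal in the Hilbert basis e with eigenvalues lam *)
Definition heat_form (R : realType) (e : int -> R -> R[i]) (lam : int -> R)
    (t : R) (f : R -> R[i]) : \bar R :=
  (\esum_(k in [set: int])
     (expR (- (t * lam k)) * sqmod (dotL2 f (e k)))%:E)%E.

(* Tr (exp (- t M)) = T: the operator M is diagonalizable and, whatever the
   diagonalization (e, lam) used to define exp (- t M) and the Hilbert basis f
   used to compute the trace, \sum_j <exp (- t M) f_j, f_j> = T. *)
Definition is_heat_trace (R : realType)
    (M : (R -> R[i]) -> (R -> R[i]) -> Prop) (t : R) (T : R) : Prop :=
  (exists e lam, diagonalizes M e lam) /\
  (forall e lam f, diagonalizes M e lam -> hilbert_basis f ->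
     (\esum_(j in [set: int]) heat_form e lam t (f j))%E = T%:E).

(** * The magnetic Laplacian (D - A_nu)^2 *)

(* A complex-valued function is differentiated through its real and imaginary
   parts, the derivatives being taken over the reals. *)
Definition cderive (R : realType) (V : normedModType R) (f : V -> R[i])
    (p w : V) : R[i] :=
  'D_w (fun q => complex.Re (f q)) p +i* 'D_w (fun q => complex.Im (f q)) p.

Definition cdifferentiable (R : realType) (V : normedModType R) (f : V -> R[i])
    (p : V) : Prop :=
  differentiable (fun q => complex.Re (f q) : R) p /\
  differentiable (fun q => complex.Im (f q) : R) p.

Definition ccontinuous_at (R : realType) (V : normedModType R) (f : V -> R[i])
    (p : V) : Prop :=
  {for p, continuous (fun q => complex.Re (f q) : R)} /\
  {for p, continuous (fun q => complex.Im (f q) : R)}.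

Definition dx (R : realType) (v : R * R -> R[i]) : R * R -> R[i] :=
  fun p => cderive v p (1, 0).

Definition dy (R : realType) (v : R * R -> R[i]) : R * R -> R[i] :=
  fun p => cderive v p (0, 1).

Definition C2_on (R : realType) (U : set (R * R)) (v : R * R -> R[i]) : Prop :=
  forall p, U p ->
  [/\ cdifferentiable v p,
      cdifferentiable (dx v) p /\ cdifferentiable (dy v) p,
      ccontinuous_at (dx (dx v)) p /\ ccontinuous_at (dx (dy v)) p
    & ccontinuous_at (dy (dx v)) p /\ ccontinuous_at (dy (dy v)) p].

Definition punctured_disk (R : realType) : set (R * R) :=
  [set p | 0 < p.1 ^+ 2 + p.2 ^+ 2 < 1].

Definition AB_potential (R : realType) (nu : R) (p : R * R) : R * R :=
  (nu / (p.1 ^+ 2 + p.2 ^+ 2) * - p.2, nu / (p.1 ^+ 2 + p.2 ^+ 2) * p.1).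

(* the two components of D - A_nu, with D = - i grad *)
Definition magDx (R : realType) (nu : R) (v : R * R -> R[i]) : R * R -> R[i] :=
  fun p => - 'i%C * dx v p - ((AB_potential nu p).1)%:C * v p.

Definition magDy (R : realType) (nu : R) (v : R * R -> R[i]) : R * R -> R[i] :=
  fun p => - 'i%C * dy v p - ((AB_potential nu p).2)%:C * v p.

Definition magnetic_laplacian (R : realType) (nu : R) (v : R * R -> R[i]) :
    R * R -> R[i] :=
  fun p => magDx nu (magDx nu v) p + magDy nu (magDy nu v) p.

(** * The Dirichlet-to-Neumann operator *)

Definition polar (R : realType) (v : R * R -> R[i]) (r theta : R) : R[i] :=
  v (r * cos theta, r * sin theta).

Definition radial_derivative (R : realType) (v : R * R -> R[i]) (r theta : R) :
    R[i] :=
  cderive (fun s : R => polar v s theta) r 1.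

(* v_k(r) = 1/(2 pi) \int_0^{2 pi} v(r, theta) e^{- i k theta} d theta *)
Definition angular_mode (R : realType) (v : R * R -> R[i]) (k : int) (r : R) :
    R[i] :=
  ((2 * pi)^-1)%:C *
  integral_circle (fun theta => polar v r theta *
                     (cos (k%:~R * theta) -i* sin (k%:~R * theta))).

(* The graph of M_nu in L^2(S^1). The boundary values v = Psi and
   d_r v = Phi at r = 1 are the limits in L^2(S^1) of the restrictions to the
   circles of radius r, as r tends to 1 from below. The values of v outside the
   punctured open disk are irrelevant. *)
Definition DtN (R : realType) (nu : R) (Psi Phi : R -> R[i]) : Prop :=
  [/\ in_L2 Psi, in_L2 Phi
    & exists v : R * R -> R[i],
      [/\ C2_on (@punctured_disk R) v,
          forall p, punctured_disk p -> magnetic_laplacian nu v p = 0,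
          forall k, exists C : R,
            \forall r \near (0 : R)^'+, sqmod (angular_mode v k r) <= C,
          sqnormL2 (fun theta => polar v r theta - Psi theta)
            @[r --> (1 : R)^'-] --> 0%E
        & sqnormL2 (fun theta => radial_derivative v r theta - Phi theta)
            @[r --> (1 : R)^'-] --> 0%E]].

(* Main.v *)
Require Import Defs.
From mathcomp Require Import all_boot all_order all_algebra.
From mathcomp Require Import all_classical all_reals all_analysis.
From mathcomp Require Import complex.
From mathcomp Require Import measurable_realfun ring lra.
Import Order.TTheory GRing.Theory Num.Theory.
Import numFieldNormedType.Exports.
Local Open Scope classical_set_scope.
Local Open Scope ring_scope.

(** Separation of variables in polar coordinates.

    An angular mode F(r) = \int v(r, theta) e^{- i k theta} d theta of a solution v of
    (D - A_nu)^2 v = 0 satisfies (r d_r)^2 F = (k - nu)^2 F on ]0, 1[: integrate by parts the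
    identity (r d_r)^2 v = (D_theta - nu)^2 v over the circle. A solution of this equation which is
    bounded at 0 satisfies r F' = |k - nu| F, hence, at r = 1, the k-th Fourier coefficient of
    M_nu Psi is |k - nu| times that of Psi. Conversely r^{|k - nu|} e^{i k theta} is a solution, so
    that M_nu is diagonal in the Fourier basis.

    If (e_k, lam_k) is another diagonalization of M_nu and E_j is the Fourier basis, then
    <e_k, E_j> vanishes unless lam_k = |j - nu|; Parseval's identity for both bases and Tonelli's
    theorem then give sum_k F(lam_k) = sum_{k, j} F(lam_k) |<e_k, E_j>|^2 = sum_j F(|j - nu|) for
    F >= 0. The trace is thus a sum of two geometric series.

    The Fourier basis is complete since the L^2-closure of the trigonometric polynomials contains
    the indicator functions of the half-lines, hence, by a monotone class argument, those of all
    the measurable sets. *)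

Set Implicit Arguments.
Unset Strict Implicit.
Unset Printing Implicit Defensive.

(** * The space L^2(S^1) *)

Section L2_circle.
Context {R : realType}.
Implicit Types (f g h : R -> R[i]) (u v w : R -> R) (c z : R[i]).
Let mu := @lebesgue_measure R.
Let C := @circle R.

(** The heat trace must take the same value for every diagonalization of M_nu, so eigenfunctions
    alone do not settle it: every pair of the graph has to be controlled. Fourier coefficients do
    this, since the relation between a mode and its radial derivative holds on each circle of radius
    r < 1, and L^2 convergence carries it to r = 1. The indicator function of ]-oo, b[ comes from a
    trigonometric polynomial of degree one which, on ]0, 2 pi[, lies below 1/2 exactly to the left
    of b, composed with polynomials that tend to a step at 1/2. Boundedness at 0 must exclude
    r^{-m}, and ln r when m = 0; a single monotone function treats both cases. The asymptotics start
    from the second closed form with s = t / 2 and w = 2 nu - 1, that is cosh (w s) / sinh s = 1 / s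
    + (w^2 / 2 - 1 / 6) s + O(s^3). *)

Lemma sqmod_ge0 z : 0 <= sqmod z.
Proof. by rewrite /sqmod addr_ge0// sqr_ge0. Qed.

Lemma sqmodM z1 z2 : sqmod (z1 * z2) = sqmod z1 * sqmod z2.
Proof. by case: z1 z2 => [a b] [x y]; rewrite /sqmod /=; ring. Qed.

Lemma sqmod_conj z : sqmod (z^*)%C = sqmod z.
Proof. by case: z => a b; rewrite /sqmod /=; ring. Qed.

Lemma sqmod_real (x : R) : sqmod (x%:C)%C = x ^+ 2.
Proof. by rewrite /sqmod /=; ring. Qed.

Lemma mulr_conj_sqmod z : z * (z^*)%C = ((sqmod z)%:C)%C.
Proof. by case: z => a b; rewrite /sqmod; apply/eqP; rewrite eq_complex /=; apply/andP; split;
  apply/eqP; ring. Qed.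

Lemma conjcM z1 z2 : ((z1 * z2)^*)%C = (z1^*)%C * (z2^*)%C.
Proof. by rewrite rmorphM. Qed.

Lemma Re_mulr_conj z : complex.Re (z * (z^*)%C) = sqmod z.
Proof. by rewrite mulr_conj_sqmod. Qed.

Lemma sqmod_eq0 z : (sqmod z == 0) = (z == 0).
Proof.
by case: z => a b; rewrite /sqmod eq_complex /= paddr_eq0 ?sqr_ge0// !sqrf_eq0.
Qed.

Lemma complexP z1 z2 : complex.Re z1 = complex.Re z2 ->
  complex.Im z1 = complex.Im z2 -> z1 = z2.
Proof. by case: z1 z2 => [a b] [x y] /= -> ->. Qed.

Lemma Re_add z1 z2 : complex.Re (z1 + z2) = complex.Re z1 + complex.Re z2.
Proof. by case: z1 z2 => [a b] [x y]. Qed.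
Lemma Im_add z1 z2 : complex.Im (z1 + z2) = complex.Im z1 + complex.Im z2.
Proof. by case: z1 z2 => [a b] [x y]. Qed.
Lemma Re_opp z : complex.Re (- z) = - complex.Re z.
Proof. by case: z. Qed.
Lemma Im_opp z : complex.Im (- z) = - complex.Im z.
Proof. by case: z. Qed.
Lemma Re_mul z1 z2 : complex.Re (z1 * z2) =
  complex.Re z1 * complex.Re z2 - complex.Im z1 * complex.Im z2.
Proof. by case: z1 z2 => [a b] [x y]. Qed.
Lemma Im_mul z1 z2 : complex.Im (z1 * z2) =
  complex.Re z1 * complex.Im z2 + complex.Im z1 * complex.Re z2.
Proof. by case: z1 z2 => [a b] [x y]. Qed.
Lemma Re_conjc z : complex.Re (z^*)%C = complex.Re z.
Proof. by case: z. Qed.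
Lemma Im_conjc z : complex.Im (z^*)%C = - complex.Im z.
Proof. by case: z. Qed.
Lemma measurable_circle : measurable C.
Proof. exact: measurable_itv. Qed.
Hint Resolve measurable_circle : core.

Lemma mu_circle : mu C = (2 * pi)%:E.
Proof.
rewrite /mu /C /circle lebesgue_measure_itv /= lte_fin.
by rewrite mulr_gt0 ?pi_gt0// sube0.
Qed.

Lemma mu_circle_lty : (mu C < +oo)%E.
Proof. by rewrite mu_circle ltry. Qed.

(** Measurability of [u] is stated apart, because that of u^2 does not imply it. *)
Definition rL2 u := measurable_fun C u /\ mu.-integrable C (EFin \o (fun x => u x ^+ 2)).

Lemma integrable_le u v : measurable_fun C u ->
  mu.-integrable C (EFin \o v) -> (forall x, C x -> `|u x| <= v x) ->
  mu.-integrable C (EFin \o u).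
Proof.
move=> mfu iv uv; apply: le_integrable iv => //; first exact/measurable_EFinP.
by move=> x Cx /=; rewrite lee_fin (le_trans (uv _ Cx))// ler_norm.
Qed.

Lemma integrableRD u v : mu.-integrable C (EFin \o u) ->
  mu.-integrable C (EFin \o v) -> mu.-integrable C (EFin \o (fun x => u x + v x)).
Proof.
move=> iu iv; rewrite (_ : _ \o _ = (EFin \o u) \+ (EFin \o v))//.
exact: integrableD.
Qed.

Lemma integrableRZ (r : R) u : mu.-integrable C (EFin \o u) ->
  mu.-integrable C (EFin \o (fun x => r * u x)).
Proof.
move=> iu; rewrite (_ : _ \o _ = fun x => r%:E * (EFin \o u) x)%E//.
exact: integrableZl.
Qed.

(** The form in which the circle is passed to differentiation under the integral sign. *)
Lemma measurable_circleR : measurable (C : set (measurableTypeR R)).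
Proof. exact: measurable_circle. Qed.

Lemma Rint_circleD u v : mu.-integrable C (EFin \o u) ->
  mu.-integrable C (EFin \o v) ->
  Rintegral mu C (fun x => u x + v x) = Rintegral mu C u + Rintegral mu C v.
Proof. by move=> iu iv; rewrite RintegralD. Qed.

Lemma Rint_circleB u v : mu.-integrable C (EFin \o u) ->
  mu.-integrable C (EFin \o v) ->
  Rintegral mu C (fun x => u x - v x) = Rintegral mu C u - Rintegral mu C v.
Proof. by move=> iu iv; rewrite RintegralB. Qed.

Lemma Rint_circleZ (r : R) u : mu.-integrable C (EFin \o u) ->
  Rintegral mu C (fun x => r * u x) = r * Rintegral mu C u.
Proof. by move=> iu; rewrite RintegralZl. Qed.

Lemma le_Rint_circle u v : mu.-integrable C (EFin \o u) ->
  mu.-integrable C (EFin \o v) -> (forall x, C x -> u x <= v x) ->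
  Rintegral mu C u <= Rintegral mu C v.
Proof. by move=> iu iv uv; apply: le_Rintegral. Qed.

(** The product is dominated by u^2 + v^2, because (|u| - |v|)^2 >= 0. *)
Lemma rL2_mul u v : rL2 u -> rL2 v -> mu.-integrable C (EFin \o (fun x => u x * v x)).
Proof.
move=> [mfu iu] [mfv iv].
apply: (@integrable_le _ (fun x => u x ^+ 2 + v x ^+ 2)).
- exact: measurable_funM.
- exact: integrableRD.
- move=> x _; rewrite normrM -(real_normK (num_real (u x))) -(real_normK (num_real (v x))).
  by have := normr_ge0 (u x); have := normr_ge0 (v x);
    have := sqr_ge0 (`|u x| - `|v x|); nra.
Qed.

Lemma rL2D u v : rL2 u -> rL2 v -> rL2 (fun x => u x + v x).
Proof.
move=> hu hv; have [mfu iu] := hu; have [mfv iv] := hv; split.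
  exact: measurable_funD.
have -> : (fun x => (u x + v x) ^+ 2) =
    (fun x => (u x ^+ 2 + v x ^+ 2) + 2 * (u x * v x)).
  by apply/funext => x; ring.
by apply: integrableRD; [exact: integrableRD|apply/integrableRZ/rL2_mul].
Qed.

Lemma rL2Z (r : R) u : rL2 u -> rL2 (fun x => r * u x).
Proof.
move=> [mfu iu]; split; first exact: measurable_funM.
have -> : (fun x => (r * u x) ^+ 2) = (fun x => r ^+ 2 * u x ^+ 2).
  by apply/funext => x; ring.
exact: integrableRZ.
Qed.

Lemma in_L2P f : in_L2 f <->
  rL2 (fun x => complex.Re (f x)) /\ rL2 (fun x => complex.Im (f x)).
Proof.
split.
  move=> [mr mi fi].
  have isq : mu.-integrable C (EFin \o (fun x => sqmod (f x))).
    apply/integrableP; split.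
      by apply/measurable_EFinP/measurable_funD; exact: measurable_funX.
    rewrite (_ : (\int[_]_(_ in _) _)%E = sqnormL2 f)//.
    by apply: eq_integral => x _ /=; rewrite ger0_norm ?sqmod_ge0.
  split; split => //.
    apply: integrable_le isq _; first exact: measurable_funX.
    by move=> x _; rewrite ger0_norm ?sqr_ge0// lerDl sqr_ge0.
  apply: integrable_le isq _; first exact: measurable_funX.
  by move=> x _; rewrite ger0_norm ?sqr_ge0// lerDr sqr_ge0.
move=> [[mr ir] [mi ii]]; split => //.
have /integrableP[_] := integrableRD ir ii.
rewrite (_ : (\int[_]_(_ in _) _)%E = sqnormL2 f)//.
by apply: eq_integral => x _ /=; rewrite ger0_norm// addr_ge0// sqr_ge0.
Qed.

Lemma integrable_bounded u (M : R) : measurable_fun C u ->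
  (forall x, C x -> `|u x| <= M) -> mu.-integrable C (EFin \o u).
Proof.
move=> mfu uM; apply: measurable_bounded_integrable => //.
  exact: mu_circle_lty.
exists M; split; first exact: num_real.
by move=> y My x Cx; exact: le_trans (uM _ Cx) (ltW My).
Qed.

Lemma rL2_bounded u (M : R) : measurable_fun C u ->
  (forall x, C x -> `|u x| <= M) -> rL2 u.
Proof.
move=> mfu uM; split => //.
apply: (@integrable_bounded _ (M ^+ 2)); first exact: measurable_funX.
move=> x Cx; rewrite normrX lerXn2r// ?nnegrE ?uM//.
exact: le_trans (uM _ Cx).
Qed.

Lemma in_L2D f g : in_L2 f -> in_L2 g -> in_L2 (fun x => f x + g x).
Proof.
move=> /in_L2P[fr fi] /in_L2P[gr gi]; apply/in_L2P.
under eq_fun do rewrite Re_add; under [X in _ /\ rL2 X]eq_fun do rewrite Im_add.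
by split; exact: rL2D.
Qed.

Lemma in_L2Z c f : in_L2 f -> in_L2 (fun x => c * f x).
Proof.
move=> /in_L2P[fr fi]; apply/in_L2P.
under eq_fun do rewrite Re_mul -mulNr; under [X in _ /\ rL2 X]eq_fun do rewrite Im_mul.
by split; apply: rL2D; exact: rL2Z.
Qed.

Lemma in_L2B f g : in_L2 f -> in_L2 g -> in_L2 (fun x => f x - g x).
Proof.
move=> hf hg; under eq_fun do rewrite -[- _]mulN1r.
by apply: in_L2D => //; exact: in_L2Z.
Qed.

Definition cintegrable f := mu.-integrable C (EFin \o (fun x => complex.Re (f x))) /\
  mu.-integrable C (EFin \o (fun x => complex.Im (f x))).

Lemma integral_circleD f g : cintegrable f -> cintegrable g ->
  integral_circle (fun x => f x + g x) = integral_circle f + integral_circle g.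
Proof.
move=> [fr fi] [gr gi]; rewrite /integral_circle; apply: complexP.
  rewrite Re_add /= -RintegralD//.
  by apply: eq_Rintegral => x _; rewrite Re_add.
rewrite Im_add /= -RintegralD//.
by apply: eq_Rintegral => x _; rewrite Im_add.
Qed.

Lemma integral_circleZ c f : cintegrable f ->
  integral_circle (fun x => c * f x) = c * integral_circle f.
Proof.
move=> [fr fi]; rewrite /integral_circle; apply: complexP.
  rewrite Re_mul /= -!RintegralZl// -RintegralB//; [|exact: integrableRZ..].
  by apply: eq_Rintegral => x _; rewrite Re_mul.
rewrite Im_mul /= -!RintegralZl// -RintegralD//; [|exact: integrableRZ..].
by apply: eq_Rintegral => x _; rewrite Im_mul.
Qed.

Lemma integral_circle_conj f : cintegrable f ->
  integral_circle (fun x => (f x)^*%C) = (integral_circle f)^*%C.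
Proof.
move=> [fr fi]; rewrite /integral_circle; apply: complexP => /=.
  by apply: eq_Rintegral => x _; rewrite Re_conjc.
rewrite -[RHS]mulN1r -RintegralZl//.
by apply: eq_Rintegral => x _; rewrite Im_conjc mulN1r.
Qed.

Lemma dot_cintegrable f g : in_L2 f -> in_L2 g -> cintegrable (fun x => f x * ((g x)^*)%C).
Proof.
move=> /in_L2P[fr fi] /in_L2P[gr gi]; split.
  under eq_fun do rewrite Re_mul Re_conjc Im_conjc mulrN opprK.
  by apply: integrableRD; exact: rL2_mul.
under eq_fun do rewrite Im_mul Re_conjc Im_conjc mulrN -mulN1r.
by apply: integrableRD; [apply: integrableRZ|]; exact: rL2_mul.
Qed.

Lemma dotL2Dl f g h : in_L2 f -> in_L2 g -> in_L2 h ->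
  dotL2 (fun x => f x + g x) h = dotL2 f h + dotL2 g h.
Proof.
move=> hf hg hh; rewrite /dotL2; under eq_fun do rewrite mulrDl.
by rewrite integral_circleD//; exact: dot_cintegrable.
Qed.

Lemma dotL2Zl c f h : in_L2 f -> in_L2 h ->
  dotL2 (fun x => c * f x) h = c * dotL2 f h.
Proof.
move=> hf hh; rewrite /dotL2; under eq_fun do rewrite -mulrA.
by rewrite integral_circleZ//; exact: dot_cintegrable.
Qed.

Lemma dotL2C f g : in_L2 f -> in_L2 g -> dotL2 f g = ((dotL2 g f)^*)%C.
Proof.
move=> hf hg; rewrite /dotL2 -integral_circle_conj; last exact: dot_cintegrable.
by congr integral_circle; apply/funext => x; rewrite rmorphM /= conjcK mulrC.
Qed.

Lemma dotL2Bl f g h : in_L2 f -> in_L2 g -> in_L2 h ->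
  dotL2 (fun x => f x - g x) h = dotL2 f h - dotL2 g h.
Proof.
move=> hf hg hh; under eq_fun do rewrite -[- _]mulN1r.
by rewrite dotL2Dl// ?dotL2Zl// ?mulN1r//; exact: in_L2Z.
Qed.

(** Defined through the inner product, so that squared norms of differences expand by
    sesquilinearity; [nrm2E] and [sqnormL2E] give back the integral. *)
Definition nrm2 f := complex.Re (dotL2 f f).

Lemma nrm2E f : nrm2 f = Rintegral mu C (fun x => sqmod (f x)).
Proof. by rewrite /nrm2 /=; apply: eq_Rintegral => x _; rewrite Re_mulr_conj. Qed.

Lemma sqnormL2E f : in_L2 f -> sqnormL2 f = (nrm2 f)%:E.
Proof.
move=> [_ _ fy]; rewrite nrm2E /Rintegral fineK// ge0_fin_numE//.
by apply: integral_ge0 => x _; rewrite lee_fin sqmod_ge0.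
Qed.

Lemma nrm2_ge0 f : 0 <= nrm2 f.
Proof. by rewrite nrm2E; apply: Rintegral_ge0 => x _; exact: sqmod_ge0. Qed.

(** Expansion of |f - c e|^2 for a unit vector [e]: the induction step of [nrm2B_sum]. *)
Lemma nrm2B_scale c f e : in_L2 f -> in_L2 e -> dotL2 e e = 1 ->
  nrm2 (fun x => f x - c * e x) =
  nrm2 f - 2 * complex.Re (dotL2 f e * (c^*)%C) + sqmod c.
Proof.
move=> hf he e1; have hce := in_L2Z c he; have hfce := in_L2B hf hce.
rewrite /nrm2 dotL2Bl// (dotL2C hf hfce) (dotL2C hce hfce) !dotL2Bl//.
rewrite !dotL2Zl// (dotL2C hf hce) (dotL2C he hce) !dotL2Zl// e1.
have -> : dotL2 e f = ((dotL2 f e)^*)%C by rewrite dotL2C.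
case: (dotL2 f f) (dotL2 f e) c {hce hfce} => [a b] [x y] [p q].
by rewrite /sqmod /=; ring.
Qed.

End L2_circle.
#[export] Hint Resolve measurable_circle : core.
#[export] Hint Resolve measurable_circleR : core.

(** * Derivation rules in pointwise form *)

Section derivation_rules.
Context {R : realType} {V : normedModType R}.
Implicit Types (f g : V -> R) (x v : V) (df dg : R).

Lemma is_derive_add f g x v df dg : is_derive x v f df -> is_derive x v g dg ->
  is_derive x v (fun y => f y + g y) (df + dg).
Proof. by move=> hf hg; exact: is_deriveD. Qed.

Lemma is_derive_sub f g x v df dg : is_derive x v f df -> is_derive x v g dg ->
  is_derive x v (fun y => f y - g y) (df - dg).
Proof. by move=> hf hg; exact: is_deriveB. Qed.

Lemma is_derive_opp f x v df : is_derive x v f df ->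
  is_derive x v (fun y => - f y) (- df).
Proof. by move=> hf; exact: is_deriveN. Qed.

Lemma is_derive_mul f g x v df dg : is_derive x v f df -> is_derive x v g dg ->
  is_derive x v (fun y => f y * g y) (f x * dg + g x * df).
Proof. by move=> hf hg; exact: is_deriveM. Qed.

Lemma is_derive_mulc (c : R) f x v df : is_derive x v f df ->
  is_derive x v (fun y => c * f y) (c * df).
Proof. by move=> hf; exact: (is_deriveZ c). Qed.

(** As [f] is only assumed to have a derivative in the direction [v], everything is restricted to
    the line t v + x, where the one-variable chain rule applies. *)
Lemma is_derive_comp_real (h : R -> R) f x v df dh :
  is_derive (f x) 1 h dh -> is_derive x v f df ->
  is_derive x v (fun y => h (f y)) (dh * df).
Proof.
move=> hh hf.
have key (g : V -> R) dg : is_derive x v g dg <-> is_derive (0 : R) 1 (fun t : R => g (t *: v +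
  x)) dg.
  have e : 'D_v g x = 'D_1 (fun t : R => g (t *: v + x)) 0.
    have E : (fun h : R => h^-1 *: ((g \o shift x) (h *: v) - g x)) =
        (fun h : R => h^-1 *: (((fun t : R => g (t *: v + x)) \o shift 0) (h *: (1 : R))
                       - (fun t : R => g (t *: v + x)) 0)).
      by apply/funext => t /=; rewrite addr0 scale0r add0r [t%:A]mulr1.
    by rewrite /derive E.
  split=> -[d <-]; split.
  - exact: (proj1 (derivable1P g x v) d).
  - exact: (esym e).
  - exact: (proj2 (derivable1P g x v) d).
  - exact: e.
apply/key; apply: (@is_derive1_comp _ h (fun t : R => f (t *: v + x))).
  by rewrite scale0r add0r.
exact/key.
Qed.

End derivation_rules.

(** * The trigonometric system and its orthonormality *)

Section trigonometric_system.
Context {R : realType}.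
Implicit Types (f g h : R -> R[i]) (u v w : R -> R) (c z : R[i]).
Let mu := @lebesgue_measure R.
Let C := @circle R.

Lemma twopi_gt0 : 0 < 2 * pi :> R.
Proof. by rewrite mulr_gt0// pi_gt0. Qed.

Lemma is_derive1_continuous (F f : R -> R) : (forall x : R, is_derive x 1 F (f x)) ->
  continuous F.
Proof.
by move=> dF x; apply: differentiable_continuous; rewrite -derivable1_diffP; have [] := dF x.
Qed.

Lemma continuous_measurable_circle u : continuous u -> measurable_fun C u.
Proof. by move=> cu; apply: measurable_funTS; exact: continuous_measurable_fun. Qed.

Lemma continuous_circle_bounded u : continuous u ->
  exists M, forall x, C x -> `|u x| <= M.
Proof.
move=> cu; have cw : {within `[0, 2 * pi], continuous (fun x => `|u x|)}.
  apply: continuous_subspaceT => x; apply: continuous_comp; first exact: cu.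
  exact: norm_continuous.
have [c _ uc] := EVT_max (ltW twopi_gt0) cw.
by exists `|u c| => x Cx; apply: uc.
Qed.

Lemma continuous_integrable_circle u : continuous u -> mu.-integrable C (EFin \o u).
Proof.
move=> cu; have [M uM] := continuous_circle_bounded cu.
by apply: (integrable_bounded (M := M)) => //; exact: continuous_measurable_circle.
Qed.

Lemma continuous_rL2 u : continuous u -> rL2 u.
Proof.
move=> cu; have [M uM] := continuous_circle_bounded cu.
by apply: (rL2_bounded (M := M)) => //; exact: continuous_measurable_circle.
Qed.

Lemma FTC_circle (F f : R -> R) : (forall x : R, is_derive x 1 F (f x)) ->
  continuous f -> Rintegral mu C f = F (2 * pi) - F 0.
Proof.
move=> dF cf; have cF := is_derive1_continuous dF.
rewrite /Rintegral (continuous_FTC2 twopi_gt0 (F := F))//.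
- exact: continuous_subspaceT.
- split; first by move=> x _; have [] := dF x.
    exact/cvg_at_right_filter/cF.
  exact/cvg_at_left_filter/cF.
- by move=> x _; rewrite derive1E; apply: derive_val.
Qed.

Lemma Rintegral_circle_cst (r : R) : Rintegral mu C (fun=> r) = r * (2 * pi).
Proof.
rewrite Rintegral_cst; last exact: measurable_circle.
by congr (_ * _); exact: (congr1 fine mu_circle).
Qed.

Definition cis (x : R) : R[i] := (cos x +i* sin x)%C.

Lemma cisD x y : cis (x + y) = cis x * cis y.
Proof. by apply: complexP; rewrite /= ?cosD ?sinD ?Re_mul ?Im_mul /=; ring. Qed.

Lemma cisN x : cis (- x) = ((cis x)^*)%C.
Proof. by apply: complexP; rewrite /= ?cosN ?sinN. Qed.

Lemma cis0 : cis 0 = 1.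
Proof. by apply: complexP; rewrite /= ?cos0 ?sin0. Qed.

Lemma sqmod_cis x : sqmod (cis x) = 1.
Proof. by rewrite /sqmod /= cos2Dsin2. Qed.

Lemma cisX x n : cis x ^+ n = cis (n%:R * x).
Proof.
elim: n => [|n ih]; first by rewrite mul0r cis0 expr0.
by rewrite exprS ih -cisD -[n.+1]addn1 natrD mulrDl mul1r addrC.
Qed.

Lemma cis_int2pi (n : int) : cis (n%:~R * (2 * pi)) = 1.
Proof.
have P (m : nat) : cis (m%:R * (2 * pi)) = 1.
  rewrite -cisX -[RHS](expr1n _ m); congr (_ ^+ _).
  by apply: complexP; rewrite /= mulr_natl ?cos2pi ?sin2pi.
case: n => m; first exact: P.
by rewrite NegzE mulrNz mulNr cisN -pmulrn P; apply: complexP; rewrite /= ?oppr0.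
Qed.

Lemma is_derive_sin_scale (a x : R) :
  is_derive x 1 (fun x => sin (a * x)) (cos (a * x) * a).
Proof.
have h := is_derive_mulc a (is_derive_id x 1); rewrite mulr1 in h.
exact: (is_derive_comp_real (h := sin) (is_derive_sin (a * x)) h).
Qed.

Lemma is_derive_cos_scale (a x : R) :
  is_derive x 1 (fun x => cos (a * x)) (- sin (a * x) * a).
Proof.
have h := is_derive_mulc a (is_derive_id x 1); rewrite mulr1 in h.
exact: (is_derive_comp_real (h := cos) (is_derive_cos (a * x)) h).
Qed.

Lemma continuous_sin_scale (a : R) : continuous (fun x => sin (a * x)).
Proof. exact: is_derive1_continuous (is_derive_sin_scale a). Qed.

Lemma continuous_cos_scale (a : R) : continuous (fun x => cos (a * x)).
Proof. exact: is_derive1_continuous (is_derive_cos_scale a). Qed.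

Lemma Rintegral_cos (n : int) : n != 0 ->
  Rintegral mu C (fun x => cos (n%:~R * x)) = 0.
Proof.
move=> n0; have n0' : n%:~R != 0 :> R by rewrite intr_eq0.
have d (x : R) : is_derive x 1 (fun x => n%:~R^-1 * sin (n%:~R * x)) (cos (n%:~R * x)).
  have := is_derive_mulc n%:~R^-1 (is_derive_sin_scale n%:~R x).
  by rewrite mulrC mulfK.
rewrite (FTC_circle d); last exact: continuous_cos_scale.
have [_ ->] : cos (n%:~R * (2 * pi)) = 1 :> R /\ sin (n%:~R * (2 * pi)) = 0 :> R.
  by have [] := cis_int2pi n.
by rewrite !mulr0 sin0 mulr0 subrr.
Qed.

Lemma Rintegral_sin (n : int) : Rintegral mu C (fun x => sin (n%:~R * x)) = 0.
Proof.
have [->|n0] := eqVneq n 0.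
  under eq_Rintegral do rewrite mul0r sin0.
  by rewrite Rintegral_circle_cst mul0r.
have n0' : n%:~R != 0 :> R by rewrite intr_eq0.
have d (x : R) : is_derive x 1 (fun x => - n%:~R^-1 * cos (n%:~R * x)) (sin (n%:~R * x)).
  have := is_derive_mulc (- n%:~R^-1) (is_derive_cos_scale n%:~R x).
  by rewrite mulNr mulrCA mulVf// mulr1 opprK.
rewrite (FTC_circle d); last exact: continuous_sin_scale.
have [-> _] : cos (n%:~R * (2 * pi)) = 1 :> R /\ sin (n%:~R * (2 * pi)) = 0 :> R.
  by have [] := cis_int2pi n.
by rewrite !mulr0 cos0 subrr.
Qed.

Lemma integral_circle_cis (n : int) :
  integral_circle (fun x => cis (n%:~R * x)) = if n == 0 then ((2 * pi)%:C)%C else 0.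
Proof.
rewrite /integral_circle /= Rintegral_sin.
have [->|n0] := eqVneq n 0; last by rewrite Rintegral_cos.
under eq_Rintegral do rewrite mul0r cos0.
by rewrite Rintegral_circle_cst mul1r.
Qed.

Lemma cis_in_L2 (a : R) : in_L2 (fun x => cis (a * x)).
Proof.
by apply/in_L2P; split; apply: continuous_rL2 => /=;
  [exact: continuous_cos_scale|exact: continuous_sin_scale].
Qed.

(** The factor normalizes for the measure d theta, of total mass 2 pi. *)
Definition fourier (k : int) (x : R) : R[i] :=
  (((Num.sqrt (2 * pi))^-1)%:C)%C * cis (k%:~R * x).

Lemma fourier_in_L2 k : in_L2 (fourier k).
Proof. exact/in_L2Z/cis_in_L2. Qed.

Lemma sqmod_fourier k x : sqmod (fourier k x) = (2 * pi)^-1.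
Proof.
by rewrite /fourier sqmodM sqmod_cis mulr1 sqmod_real exprVn sqr_sqrtr// ltW// twopi_gt0.
Qed.

Lemma dotL2_cis (j k : int) :
  dotL2 (fun x => cis (j%:~R * x)) (fun x => cis (k%:~R * x)) =
  if j == k then ((2 * pi)%:C)%C else 0.
Proof.
rewrite -subr_eq0 -integral_circle_cis /dotL2; congr integral_circle.
by apply/funext => x; rewrite -cisN -cisD rmorphB /= mulrBl.
Qed.

Lemma dotL2_fourier_cis f k : in_L2 f ->
  dotL2 f (fourier k) =
  (((Num.sqrt (2 * pi))^-1)%:C)%C * dotL2 f (fun x => cis (k%:~R * x)).
Proof.
move=> hf; have hk := cis_in_L2 k%:~R.
rewrite (dotL2C hf (fourier_in_L2 k)) dotL2Zl// rmorphM (dotL2C hf hk).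
by congr (_ * _); apply: complexP => //=; rewrite oppr0.
Qed.

Lemma dotL2_fourier (j k : int) : dotL2 (fourier j) (fourier k) = (j == k)%:R.
Proof.
have hj := cis_in_L2 j%:~R.
rewrite dotL2_fourier_cis; last exact: fourier_in_L2.
rewrite dotL2Zl//; last exact: cis_in_L2.
rewrite dotL2_cis; case: ifP => _; last by rewrite !mulr0.
rewrite -!rmorphM /= mulrA -expr2 exprVn sqr_sqrtr ?(ltW twopi_gt0)//.
by rewrite mulVf// gt_eqF// twopi_gt0.
Qed.

End trigonometric_system.

(** * Orthonormal families: Bessel's inequality and Parseval's identity *)

Section orthonormal.
Context {R : realType}.
Variable e : int -> R -> R[i].
Hypothesis eL2 : forall k, in_L2 (e k).
Hypothesis eo : forall j k, dotL2 (e j) (e k) = (j == k)%:R.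

Lemma in_L2_sum (I : eqType) (s : seq I) (a : I -> R[i]) (h : I -> R -> R[i]) :
  (forall k, in_L2 (h k)) -> in_L2 (fun x => \sum_(k <- s) a k * h k x).
Proof.
move=> hL2; elim: s => [|k s ih].
  under eq_fun do rewrite big_nil -(mul0r 1).
  apply: (@in_L2Z _ 0 (fun=> 1)); apply/in_L2P => /=.
  by split; apply: continuous_rL2; exact: cst_continuous.
under eq_fun do rewrite big_cons.
by apply: in_L2D => //; exact: in_L2Z.
Qed.

(** Peeling off one term replaces [f] by [f - a k * e k], which has the same coefficients as [f]
    against the remaining vectors, since these differ from e_k by [uniq s]. *)
Lemma nrm2B_sum (s : seq int) (a : int -> R[i]) f : in_L2 f -> uniq s ->
  nrm2 (fun x => f x - \sum_(k <- s) a k * e k x) =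
  nrm2 f + \sum_(k <- s)
    (sqmod (a k) - 2 * complex.Re (dotL2 f (e k) * ((a k)^*)%C)).
Proof.
elim: s f => [|k s ih] f hf /=.
  by move=> _; rewrite big_nil addr0; under eq_fun do rewrite big_nil subr0.
move=> /andP[ks us].
under eq_fun do rewrite big_cons opprD addrA.
have hk : in_L2 (fun x => a k * e k x) by exact: in_L2Z.
rewrite ih//; last exact: in_L2B.
rewrite nrm2B_scale ?eo ?eqxx// big_cons.
rewrite (eq_big_seq (fun j => sqmod (a j) - 2 * complex.Re (dotL2 f (e j) * ((a j)^*)%C))).
  by set S := \sum_(_ <- _) _; ring.
move=> j js /=; rewrite dotL2Bl// dotL2Zl// eo.
by rewrite (_ : k == j = false) ?mulr0 ?subr0//; apply: contraNF ks => /eqP ->.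
Qed.

Lemma bessel (s : seq int) f : in_L2 f -> uniq s ->
  \sum_(k <- s) sqmod (dotL2 f (e k)) <= nrm2 f.
Proof.
move=> hf us; have := nrm2B_sum (fun k => dotL2 f (e k)) hf us.
under [X in _ + X]eq_bigr do rewrite Re_mulr_conj mulr_natl mulr2n opprD addrA subrr sub0r.
by rewrite sumrN => h; rewrite -subr_ge0 -h nrm2_ge0.
Qed.

(** Completing the square: each term of [nrm2B_sum] plus |<f, e_k>|^2 is |a_k - <f, e_k>|^2. An
    arbitrary approximant thus bounds the defect in Bessel's inequality. *)
Lemma nrm2_le_approx (s : seq int) (a : int -> R[i]) f : in_L2 f -> uniq s ->
  nrm2 f <= nrm2 (fun x => f x - \sum_(k <- s) a k * e k x) +
            \sum_(k <- s) sqmod (dotL2 f (e k)).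
Proof.
move=> hf us; rewrite nrm2B_sum// -addrA lerDl -big_split /=.
apply: sumr_ge0 => k _.
case: (dotL2 f (e k)) (a k) => [x y] [p q]; rewrite /sqmod /=.
have := sqr_ge0 (x - p); have := sqr_ge0 (y - q); nra.
Qed.

(** Bessel's inequality bounds every finite partial sum; [nrm2_le_approx] gives the converse up to
    eps. *)
Lemma parseval_of_approx f : in_L2 f ->
  (forall eps, 0 < eps -> exists s (a : int -> R[i]), uniq s /\
     nrm2 (fun x => f x - \sum_(k <- s) a k * e k x) <= eps) ->
  (\esum_(k in [set: int]) (sqmod (dotL2 f (e k)))%:E)%E = sqnormL2 f.
Proof.
move=> hf app; rewrite sqnormL2E//; apply/eqP; rewrite eq_le; apply/andP; split.
  rewrite /esum; apply: ge_ereal_sup => _ [X [finX _] <-].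
  rewrite fsbig_finite//= sumEFin lee_fin; apply: bessel => //.
  exact: finmap.fset_uniq.
apply/lee_addgt0Pr => eps e0.
have [s [a [us sa]]] := app _ e0.
have h := nrm2_le_approx a hf us.
have : ((nrm2 f)%:E <= (\sum_(k <- s) sqmod (dotL2 f (e k)))%:E + eps%:E)%E.
  by rewrite -EFinD lee_fin (le_trans h)// addrC lerD2l.
move=> /le_trans; apply; rewrite leeD2r//.
apply: esum_ge; exists [set` s]; first by split => //; exact: finite_seq.
by rewrite -sumEFin fsbig_seq.
Qed.

End orthonormal.

(** * Completeness of the trigonometric system *)

Section completeness.
Context {R : realType}.
Implicit Types (f g h : R -> R[i]) (u v w : R -> R) (c z : R[i]).
Let mu := @lebesgue_measure R.
Let C := @circle R.

(** Laurent polynomials in e^{i x}, with the negative powers gathered in one factor, so that sums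
    and products come from those of [{poly R[i]}]. *)
Definition trig_poly f := exists (N : nat) (p : {poly R[i]}),
  f = fun x => cis (- N%:R * x) * p.[cis x].

Lemma trig_cst c : trig_poly (fun=> c).
Proof.
by exists 0%N, c%:P; apply/funext => x; rewrite oppr0 mul0r cis0 mul1r hornerC.
Qed.

Lemma trigD f g : trig_poly f -> trig_poly g -> trig_poly (fun x => f x + g x).
Proof.
move=> [N [p ->]] [M [q ->]]; exists (N + M)%N, ('X^M * p + 'X^N * q).
apply/funext => x; rewrite hornerD !hornerM !hornerXn !cisX natrD opprD mulrDl cisD.
have e (K : nat) : cis (- K%:R * x) * cis (K%:R * x) = 1.
  by rewrite -cisD -mulrDl addNr mul0r cis0.
rewrite mulrDr -!mulrA [cis (- M%:R * x) * (_ * p.[_])]mulrA e mul1r.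
by rewrite [cis (- N%:R * x) * (_ * _) in RHS]mulrCA [cis (- N%:R * x) * (_ * q.[_])]mulrA e mul1r.
Qed.

Lemma trigM f g : trig_poly f -> trig_poly g -> trig_poly (fun x => f x * g x).
Proof.
move=> [N [p ->]] [M [q ->]]; exists (N + M)%N, (p * q).
by apply/funext => x; rewrite hornerM natrD opprD mulrDl cisD mulrACA.
Qed.

Lemma trigX f n : trig_poly f -> trig_poly (fun x => f x ^+ n).
Proof.
move=> hf; elim: n => [|n ih].
  by under eq_fun do rewrite expr0; exact: trig_cst.
by under eq_fun do rewrite exprS; exact: trigM.
Qed.

Lemma trig_cos_shift (a : R) : trig_poly (fun x => ((cos (x - a))%:C)%C).
Proof.
have -> : (fun x => ((cos (x - a))%:C)%C) =
  (fun x => (((2^-1)%:C)%C * cis (- a)) * cis x + (((2^-1)%:C)%C * cis a) * cis (- x)).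
  apply/funext => x; rewrite -!mulrA -!cisD [- a + x]addrC -[a - x]opprB cisN.
  by rewrite -mulrDr; apply: complexP; rewrite /= ?Re_mul ?Im_mul ?Re_add ?Im_add /=; field.
apply: trigD; apply: trigM; try exact: trig_cst.
  by exists 0%N, 'X; apply/funext => x; rewrite oppr0 mul0r cis0 mul1r hornerX.
by exists 1%N, 1; apply/funext => x; rewrite hornerC mulr1 mulN1r.
Qed.

Lemma trig_span f : trig_poly f -> exists s (a : int -> R[i]), uniq s /\
  f = fun x => \sum_(k <- s) a k * fourier k x.
Proof.
move=> [N [p ->]]; exists [seq (Posz i - Posz N) | i <- iota 0 (size p)].
(* On the chosen list [k + N] is the index [i], so [absz] merely converts it back to [nat]; sqrt(2
   pi) undoes the normalization of [fourier]. *)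
exists (fun k : int => p`_(absz (k + N%:Z)) * ((Num.sqrt (2 * pi))%:C)%C); split.
  by rewrite map_inj_uniq ?iota_uniq// => i j /addIr [].
apply/funext => x; rewrite big_map -{1}[size p]subn0 -/(index_iota 0 (size p)) big_mkord.
rewrite horner_coef mulr_sumr; apply: eq_bigr => i _.
rewrite subrK absz_nat /fourier [RHS]mulrA -[X in _ = X * _]mulrA -rmorphM /= divff; last first.
  by rewrite gt_eqF// sqrtr_gt0 twopi_gt0.
rewrite mulr1 cisX mulrCA -cisD intrD mulrDl mulrNz mulNr.
by rewrite addrC -pmulrn.
Qed.

Lemma trig_in_L2 f : trig_poly f -> in_L2 f.
Proof.
move=> /trig_span[s [a [_ ->]]]; apply: in_L2_sum; exact: fourier_in_L2.
Qed.

Lemma nrm2Z c f : in_L2 f -> nrm2 (fun x => c * f x) = sqmod c * nrm2 f.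
Proof.
move=> hf; rewrite /nrm2; have hc := in_L2Z c hf.
rewrite dotL2Zl// (dotL2C hf hc) dotL2Zl// conjcM -(dotL2C hf hf) mulrA.
by rewrite mulr_conj_sqmod; case: (dotL2 f f) => a b /=; rewrite mul0r subr0.
Qed.

Lemma nrm2_integrable f : in_L2 f -> mu.-integrable C (EFin \o (fun x => sqmod (f x))).
Proof.
move=> hf; have [+ _] := dot_cintegrable hf hf.
by under eq_fun do rewrite Re_mulr_conj.
Qed.

(** Takes the place of the triangle inequality for squared norms; its factor 2, applied to two
    errors, is the origin of [e / 4] in the closure lemmas. *)
Lemma nrm2D_le f g : in_L2 f -> in_L2 g ->
  nrm2 (fun x => f x + g x) <= 2 * (nrm2 f + nrm2 g).
Proof.
move=> hf hg; have fi := nrm2_integrable hf; have gi := nrm2_integrable hg.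
have ifg := integrableRD fi gi.
have -> : 2 * (nrm2 f + nrm2 g) =
    Rintegral mu C (fun x => 2 * (sqmod (f x) + sqmod (g x))).
  by rewrite Rint_circleZ// Rint_circleD// !nrm2E.
rewrite nrm2E; apply: le_Rint_circle => //.
- exact/nrm2_integrable/in_L2D.
- exact/integrableRZ/integrableRD.
- move=> x _; case: (f x) (g x) => [a b] [p q]; rewrite /sqmod /=.
  have := sqr_ge0 (a - p); have := sqr_ge0 (b - q); nra.
Qed.

Definition trig_closure f := in_L2 f /\ forall eps, 0 < eps ->
  exists2 P, trig_poly P & nrm2 (fun x => f x - P x) <= eps.

Lemma trig_closure_trig f : trig_poly f -> trig_closure f.
Proof.
move=> tf; split; first exact: trig_in_L2.
move=> e e0; exists f => //; under eq_fun do rewrite subrr.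
rewrite nrm2E; under eq_Rintegral do rewrite /sqmod /= expr0n /= addr0.
by rewrite Rintegral_circle_cst mul0r ltW.
Qed.

Lemma trig_closureD f g : trig_closure f -> trig_closure g ->
  trig_closure (fun x => f x + g x).
Proof.
move=> [hf cf] [hg cg]; split; first exact: in_L2D.
move=> e e0; have e4 : 0 < e / 4 by rewrite divr_gt0.
have [P tP fP] := cf _ e4; have [Q tQ gQ] := cg _ e4.
exists (fun x => P x + Q x); first exact: trigD.
have -> : (fun x => f x + g x - (P x + Q x)) = (fun x => (f x - P x) + (g x - Q x)).
  by apply/funext => x; rewrite opprD addrACA.
apply: (le_trans (nrm2D_le (in_L2B hf (trig_in_L2 tP)) (in_L2B hg (trig_in_L2 tQ)))).
lra.
Qed.

Lemma trig_closureZ c f : trig_closure f -> trig_closure (fun x => c * f x).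
Proof.
(* Dividing by [sqmod c + 1] rather than [sqmod c] also covers c = 0. *)
move=> [hf cf]; split; first exact: in_L2Z.
move=> e e0; have c0 : 0 < sqmod c + 1 by rewrite ltr_wpDl// sqmod_ge0.
have [P tP fP] := cf _ (divr_gt0 e0 c0).
exists (fun x => c * P x); first by apply: trigM => //; exact: trig_cst.
under eq_fun do rewrite -mulrBr.
rewrite nrm2Z; last exact: in_L2B (trig_in_L2 tP).
move: fP; rewrite ler_pdivlMr// => /(le_trans _); apply.
by rewrite mulrC ler_wpM2l ?nrm2_ge0// lerDl.
Qed.

Lemma trig_closure_lim f : in_L2 f -> (forall eps, 0 < eps ->
  exists2 g, trig_closure g & nrm2 (fun x => f x - g x) <= eps) -> trig_closure f.
Proof.
move=> hf app; split=> // e e0; have e4 : 0 < e / 4 by rewrite divr_gt0.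
have [g [hg cg] fg] := app _ e4; have [P tP gP] := cg _ e4.
exists P => //.
have -> : (fun x => f x - P x) = (fun x => (f x - g x) + (g x - P x)).
  by apply/funext => x; rewrite addrA subrK.
apply: (le_trans (nrm2D_le (in_L2B hf hg) (in_L2B hg (trig_in_L2 tP)))).
lra.
Qed.

(** Dominated convergence applied to |f - f_n|^2. Convergence is asked almost everywhere because the
    approximations of a half-line have the wrong limit at finitely many points. *)
Lemma trig_closure_dominated (f_ : nat -> R -> R[i]) f u :
  in_L2 f -> (forall n, trig_closure (f_ n)) ->
  {ae mu, forall x, C x -> sqmod (f x - f_ n x) @[n --> \oo] --> 0} ->
  mu.-integrable C (EFin \o u) ->
  (forall n x, C x -> sqmod (f x - f_ n x) <= u x) ->
  trig_closure f.
Proof.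
move=> hf cf lim iu fu; apply: trig_closure_lim => // e e0.
have h n : in_L2 (fun x => f x - f_ n x) by apply: in_L2B => //; case: (cf n).
have [] := @dominated_convergence _ _ _ mu C measurable_circle
  (fun n x => (sqmod (f x - f_ n x))%:E) (cst 0%E) (EFin \o u).
- by move=> n; have /(measurable_int mu) := nrm2_integrable (h n).
- exact: measurable_cst.
- case: lim => N [mN N0 sN]; exists N; split => //; apply: subset_trans sN.
  by apply: subsetC => x cx Cx; apply: cvg_EFin; [exact: nearW|exact: cx].
- exact: iu.
- by apply: aeW => x n Cx; rewrite /= lee_fin ger0_norm ?sqmod_ge0// fu.
move=> _ + _ => /fine_cvgP[_ /cvgr0Pnorm_lt/(_ _ e0)] [N _ /(_ N (leqnn _))] /=.
move=> lte; exists (f_ N) => //; apply: ltW; apply: le_lt_trans lte.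
apply: le_trans (ler_norm _); rewrite nrm2E.
rewrite le_eqVlt; apply/orP; left; apply/eqP.
congr fine; apply: eq_integral => x _.
by rewrite subr0 ger0_norm ?sqmod_ge0.
Qed.

End completeness.

(** * Approximation of the indicator functions of half-lines *)

Section density.
Context {R : realType}.
Implicit Types (f g h : R -> R[i]) (u v w : R -> R) (c z : R[i]).
Let mu := @lebesgue_measure R.
Let C := @circle R.

Lemma bernoulli_ineq (x : R) n : -1 <= x -> 1 + n%:R * x <= (1 + x) ^+ n.
Proof.
move=> x1; elim: n => [|n ih]; first by rewrite mul0r addr0 expr0.
rewrite exprS; have : (1 + x) * (1 + n%:R * x) <= (1 + x) * (1 + x) ^+ n.
  by rewrite ler_wpM2l//; lra.
apply: le_trans; rewrite -[n.+1]addn1 natrD.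
by have := sqr_ge0 x; have := ler0n R n; nra.
Qed.

(* The polynomials of Brosowski and Deutsch, which tend to the indicator function of [0, 1/2[. *)
Definition step_poly (n : nat) (y : R) : R := (1 - y ^+ n) ^+ (2 ^ n).

Lemma step_poly_01 n (y : R) : 0 <= y <= 1 -> 0 <= step_poly n y <= 1.
Proof.
move=> /andP[y0 y1]; have h0 : 0 <= y ^+ n by exact: exprn_ge0.
have h1 : y ^+ n <= 1 by exact: exprn_ile1.
by rewrite /step_poly exprn_ge0 ?subr_ge0//= exprn_ile1 ?subr_ge0// lerBlDr lerDl.
Qed.

(** Bernoulli's inequality at - y^n; the bound tends to 1 when 2 y < 1. *)
Lemma step_poly_lt n (y : R) : 0 <= y <= 1 -> 1 - (2 * y) ^+ n <= step_poly n y.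
Proof.
move=> /andP[y0 y1]; have := @bernoulli_ineq (- y ^+ n) (2 ^ n).
rewrite lerN2 exprn_ile1// => /(_ isT); apply: le_trans.
by rewrite natrX mulrN exprMn.
Qed.

(** With z = y^n and N = 2^n: (1 - z)^N (1 + z)^N <= 1, while (1 + z)^N >= N z = (2 y)^n by
    Bernoulli's inequality. *)
Lemma step_poly_gt n (y : R) : 0 < y <= 1 -> step_poly n y <= ((2 * y)^-1) ^+ n.
Proof.
move=> /andP[y0 y1]; have h0 : 0 < y ^+ n by exact: exprn_gt0.
have h1 : y ^+ n <= 1 by rewrite exprn_ile1// ltW.
have := @bernoulli_ineq (y ^+ n) (2 ^ n).
rewrite (@le_trans _ _ 0)//; last exact: ltW.
move=> /(_ isT) h2; have h3 : (2 * y) ^+ n <= (1 + y ^+ n) ^+ (2 ^ n).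
  by apply: le_trans h2; rewrite natrX exprMn lerDr.
have y2 : 0 < (2 * y) ^+ n by rewrite exprn_gt0// mulr_gt0.
rewrite exprVn -[leRHS]mul1r ler_pdivlMr//.
have := ler_wpM2l (exprn_ge0 (2 ^ n) (_ : 0 <= 1 - y ^+ n)) h3.
rewrite subr_ge0 h1 => /(_ isT) /le_trans; apply.
rewrite -exprMn; apply: exprn_ile1; nra.
Qed.

Lemma step_poly_cvg (y : R) : 0 <= y <= 1 -> y != 2^-1 ->
  step_poly n y @[n --> \oo] --> ((y < 2^-1)%R%:R : R).
Proof.
move=> /[dup] y01 /andP[y0 y1] yh.
have [yl|yg|/eqP] := ltgtP y 2^-1; last by rewrite (negbTE yh).
- apply: (@squeeze_cvgr _ _ _ _ (fun n => (1 : R) - (2 * y) ^+ n) (cst 1)).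
  + by apply: nearW => n; rewrite step_poly_lt//=; case/andP: (step_poly_01 n y01).
  + rewrite -[X in _ --> X]subr0; apply: cvgB; first exact: cvg_cst.
    by apply: cvg_expr; rewrite ger0_norm; lra.
  + exact: cvg_cst.
- apply: (@squeeze_cvgr _ _ _ _ (cst 0) (fun n => ((2 * y)^-1) ^+ n)).
  + by apply: nearW => n; rewrite step_poly_gt ?andbT; [case/andP: (step_poly_01 n y01) => ->|lra].
  + exact: cvg_cst.
  + apply: cvg_expr; rewrite ger0_norm ?invr_ge0; last lra.
    by rewrite invf_lt1; lra.
Qed.

Lemma cosB_cos_half (b x : R) :
  cos (b / 2) - cos (x - b / 2) = 2 * (sin (x / 2) * sin ((x - b) / 2)).
Proof.
have -> : b / 2 = x / 2 - (x - b) / 2 by field.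
have -> : x - (x / 2 - (x - b) / 2) = x / 2 + (x - b) / 2 by field.
by rewrite cosB cosD; ring.
Qed.

(** The difference of cosines vanishes at [b] and, thanks to the shift b / 2, at the endpoints 0 and
    2 pi only. Adding 1/2 places the sign change at the threshold of [step_poly], and dividing by 4
    keeps the values in [0, 1]. *)
Definition half_line_fun (b x : R) : R := 2^-1 + (cos (b / 2) - cos (x - b / 2)) / 4.

Lemma half_line_fun_01 b x : 0 <= half_line_fun b x <= 1.
Proof.
rewrite /half_line_fun; have := cos_geN1 (b / 2); have := cos_le1 (b / 2).
have := cos_geN1 (x - b / 2); have := cos_le1 (x - b / 2); lra.
Qed.

(** In the product of [cosB_cos_half], sin (x / 2) is positive and sin ((x - b) / 2) has the sign of
    x - b, as |x - b| < 2 pi. *)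
Lemma half_line_fun_lt b x : 0 < b < 2 * pi -> 0 < x < 2 * pi -> x != b ->
  half_line_fun b x != 2^-1 /\ (half_line_fun b x < 2^-1) = (x < b).
Proof.
move=> /andP[b0 b1] /andP[x0 x1] xb; rewrite /half_line_fun cosB_cos_half.
have s1 : 0 < sin (x / 2) by apply: sin_gt0_pi; lra.
have [h|h|h] := ltgtP x b; last by rewrite h eqxx in xb.
- have s2 : 0 < sin (- ((x - b) / 2)) by apply: sin_gt0_pi; lra.
  rewrite sinN in s2; have : 0 < sin (x / 2) * - sin ((x - b) / 2) by exact: mulr_gt0.
  rewrite mulrN => P; split; last by apply/idP; lra.
  by rewrite lt_eqF//; lra.
- have s2 : 0 < sin ((x - b) / 2) by apply: sin_gt0_pi; lra.
  have P : 0 < sin (x / 2) * sin ((x - b) / 2) by exact: mulr_gt0.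
  split; last by apply/negbTE; rewrite -leNgt; lra.
  by rewrite gt_eqF//; lra.
Qed.

Definition rclosure u := trig_closure (fun x => ((u x)%:C)%C).

Lemma rL2_in_L2 u : rL2 u -> in_L2 (fun x => ((u x)%:C)%C).
Proof.
move=> hu; apply/in_L2P; split => //=; apply: continuous_rL2; exact: cst_continuous.
Qed.

Lemma rclosureD u v : rclosure u -> rclosure v -> rclosure (fun x => u x + v x).
Proof.
move=> hu hv; have := trig_closureD hu hv.
by under eq_fun do rewrite -rmorphD.
Qed.

Lemma rclosureZ (r : R) u : rclosure u -> rclosure (fun x => r * u x).
Proof.
move=> hu; have := trig_closureZ ((r%:C)%C) hu.
by under eq_fun do rewrite -rmorphM.
Qed.

Lemma rclosure_cst (r : R) : rclosure (fun=> r).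
Proof. exact/trig_closure_trig/trig_cst. Qed.

Lemma rclosure_dominated (u_ : nat -> R -> R) u v :
  rL2 u -> (forall n, rclosure (u_ n)) ->
  {ae mu, forall x, C x -> u_ n x @[n --> \oo] --> u x} ->
  mu.-integrable C (EFin \o v) ->
  (forall n x, C x -> (u x - u_ n x) ^+ 2 <= v x) ->
  rclosure u.
Proof.
move=> hu cu [N [mN N0 sN]] iv uv.
have e n x : sqmod (((u x)%:C)%C - ((u_ n x)%:C)%C) = (u x - u_ n x) ^+ 2.
  by rewrite -rmorphB sqmod_real.
apply: (trig_closure_dominated (rL2_in_L2 hu) cu (u := v)) => //; last first.
  by move=> n x Cx; rewrite e uv.
exists N; split => //; apply: subset_trans sN; apply: subsetC => x cx Cx.
under eq_fun do rewrite e expr2.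
rewrite -[0](mulr0 0) -[X in X * _](subrr (u x)) -[X in _ * X](subrr (u x)).
by apply: cvgM; apply: cvgB; try exact: cvg_cst; exact: cx.
Qed.

Lemma rL2_indic (A : set (measurableTypeR R)) : measurable A -> rL2 (\1_A : R -> R).
Proof.
move=> mA; apply: (rL2_bounded (M := 1)); first exact: measurable_indic.
by move=> x _; rewrite indicE; case: (x \in A); rewrite ?normr1 ?normr0.
Qed.

(** The closure sees only the values on the circle: dominated convergence for a constant sequence,
    with bound 0. *)
Lemma rclosure_ext u v : rclosure u -> (forall x, C x -> u x = v x) ->
  rL2 v -> rclosure v.
Proof.
move=> hu uv hv; apply: (rclosure_dominated (u_ := fun=> u) (v := cst 0)) => //.
- apply: aeW => x Cx; rewrite uv//; exact: cvg_cst.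
- by apply: integrable_bounded => //= x _; rewrite normr0.
- by move=> _ x Cx; rewrite uv// subrr expr0n.
Qed.

Lemma rclosure_half_line (b : R) : rclosure (\1_(`]-oo, b[%classic : set R)).
Proof.
have mb : measurable (`]-oo, b[%classic : set (measurableTypeR R)) by exact: measurable_itv.
have [b0|b0] := leP b 0.
  apply: (rclosure_ext (rclosure_cst 0)); last exact: rL2_indic.
  move=> x; rewrite /C /circle /= in_itv/= => /andP[x0 _].
  by rewrite indicE memNset//= in_itv /=; apply/negP; rewrite -leNgt (le_trans b0).
have [b1|b1] := leP (2 * pi) b.
  (* When b = 2 pi the half-line misses the endpoint 2 pi, so it agrees with the constant 1 only
     almost everywhere on the circle. *)
  apply: (rclosure_dominated (u_ := fun=> cst 1) (v := cst 1)).
  - exact: rL2_indic.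
  - by move=> _; exact: rclosure_cst.
  - exists [set 2 * pi]; split => //; first exact: lebesgue_measure_set1.
    move=> x /= /not_implyP[]; rewrite /C /circle /= in_itv/= => /andP[x0 x1] nx.
    apply/eqP; rewrite eq_le x1 leNgt; apply/negP => x2; apply: nx.
    rewrite indicE mem_set /= ?in_itv /= ?(lt_le_trans x2)//; exact: cvg_cst.
  - by apply: (integrable_bounded (M := 1)) => //= x _; rewrite normr1.
  - move=> _ x _ /=; rewrite indicE; case: (_ \in _); rewrite ?subrr ?expr0n//.
    by rewrite sub0r sqrrN expr1n.
have bb : 0 < b < 2 * pi by rewrite b0.
apply: (rclosure_dominated (u_ := fun n x => step_poly n (half_line_fun b x)) (v := cst 1)).
- exact: rL2_indic.
- move=> n; apply: trig_closure_trig; rewrite /step_poly.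
  under eq_fun do rewrite rmorphXn rmorphB rmorphXn.
  apply: trigX; apply: trigD; first exact: trig_cst.
  under eq_fun do rewrite -mulN1r; apply: trigM; first exact: trig_cst.
  apply: trigX; rewrite /half_line_fun.
  under eq_fun do rewrite rmorphD rmorphM rmorphB.
  apply: trigD; first exact: trig_cst.
  apply: trigM; last exact: trig_cst.
  apply: trigD; first exact: trig_cst.
  under eq_fun do rewrite -mulN1r; apply: trigM; first exact: trig_cst.
  exact: trig_cos_shift.
(* At these points [half_line_fun] is 1/2, where [step_poly] tends to 1/e. *)
- exists ([set 0] `|` [set b] `|` [set 2 * pi]); split.
  + by apply: measurableU => //; exact: measurableU.
  + apply: countable_lebesgue_measure0; apply: finite_set_countable.
    by rewrite !finite_setU; split; [split|].
  + move=> x /= /not_implyP[]; rewrite /C /circle /= in_itv/= => /andP[x0 x1] nx.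
    apply: contrapT => /not_orP[/not_orP[/eqP n0 /eqP nb] /eqP n2]; apply: nx.
    have xx : 0 < x < 2 * pi by rewrite !lt_neqAle x0 x1 n2 eq_sym n0.
    have [h1 h2] := half_line_fun_lt bb xx nb.
    have -> : \1_(`]-oo, b[%classic : set R) x = (half_line_fun b x < 2^-1)%R%:R :> R.
      rewrite h2 indicE; congr (_%:R); congr nat_of_bool.
      by apply/idP/idP; rewrite ?inE /= in_itv.
    by apply: step_poly_cvg => //; exact: half_line_fun_01.
- by apply: (integrable_bounded (M := 1)) => //= x _; rewrite normr1.
- move=> n x _ /=; have /andP[] := step_poly_01 n (half_line_fun_01 b x).
  by rewrite indicE; case: (_ \in _) => /=; set s := step_poly _ _; nra.
Qed.

End density.

(** * From half-lines to all square-integrable functions *)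

Section parseval.
Context {R : realType}.
Implicit Types (f g h : R -> R[i]) (u v w : R -> R) (c z : R[i]).
Let mu := @lebesgue_measure R.
Let C := @circle R.

(** Indicator functions add up over disjoint unions only, which calls for Dynkin's theorem; the
    half-lines generate the Borel sets and are stable under intersection. *)
Lemma rclosure_measurable (A : set (measurableTypeR R)) : measurable A ->
  rclosure (\1_A : R -> R).
Proof.
move=> mA.
have mE : @measurable _ (measurableTypeR R) = <<s @RGenInftyO.G R >>.
  exact: RGenInftyO.measurableE.
apply: (@dynkin_induction _ (measurableTypeR R) (@RGenInftyO.G R)
  (fun A => rclosure (\1_A : R -> R))) => //; last by rewrite -mE.
- move=> _ _ [x ->] [y ->]; exists (Num.min x y).
  by apply/seteqP; split => z /=; rewrite !in_itv /= lt_min; [case=> -> ->|move/andP].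
- by rewrite indicT; exact: rclosure_cst.
- by move=> _ [x ->]; exact: rclosure_half_line.
- move=> S mS cS; have := rclosureD (rclosure_cst 1) (rclosureZ (-1) cS).
  suff -> : (fun x => 1 + -1 * \1_S x) = (\1_(~` S) : R -> R) by [].
  apply/funext => x; rewrite indicC mulN1r indicE.
  by case: (x \in S); rewrite ?subrr ?subr0.
- move=> F mF tF cF; pose U n := \big[setU/set0]_(k < n) F k.
  have cU n : rclosure (\1_(U n) : R -> R).
    elim: n => [|n ih].
      by rewrite /U big_ord0 indic0; exact: rclosure_cst.
    rewrite (_ : \1_(U n.+1) = (fun x => \1_(U n) x + \1_(F n) x)); first exact: rclosureD.
    apply/funext => x; rewrite /U big_ord_recr /= !indicE in_setU.
    have [xU|] := boolP (x \in \big[setU/set0]_(i < n) F i) => //=; last by rewrite add0r.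
    have [xF|] := boolP (x \in F n) => /=; last by rewrite addr0.
    move: xU xF; rewrite !inE -bigcup_mkord => -[k /= kn Fk] Fn.
    have kE : k = n by apply: tF => //; exists x.
    by rewrite kE ltnn in kn.
  apply: (rclosure_dominated (u_ := fun n => \1_(U n)) (v := cst 1)) => //.
  + exact/rL2_indic/bigcup_measurable.
  + apply: aeW => x Cx; apply: cvg_near_cst.
    have [[k _ Fk]|nF] := pselect ((\bigcup_k F k) x).
      exists k.+1 => // n /= kn; apply/eqP; rewrite !indicE !mem_set//; first by exists k.
      by rewrite /U -bigcup_mkord; exists k.
    apply: nearW => n; apply/eqP; rewrite !indicE !memNset//.
    by rewrite /U -bigcup_mkord => -[k _ Fk]; apply: nF; exists k.
  + by apply: (integrable_bounded (M := 1)) => //= x _; rewrite normr1.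
  + by move=> n x _; rewrite !indicE; do 2 case: (_ \in _) => /=; nra.
Qed.

Import HBSimple HBNNSimple.

Lemma rclosure_nnsfun (g : {nnsfun (measurableTypeR R) >-> R}) : rclosure (g : R -> R).
Proof.
rewrite (_ : (g : R -> R) = fun x => \sum_(y <- finmap.enum_fset (fset_set (range g))) y * \1_(g
  @^-1` [set y]) x).
  elim: (finmap.enum_fset _) => [|y s ih].
    by under eq_fun do rewrite big_nil; exact: rclosure_cst.
  under eq_fun do rewrite big_cons.
  by apply: rclosureD => //; apply/rclosureZ/rclosure_measurable.
by apply/funext => x; rewrite {1}fimfunE fsbig_finite.
Qed.

(** For simple functions 0 <= g_n <= u that tend to u, the squared error is dominated by u^2. *)
Lemma rclosure_ge0 u : rL2 u -> (forall x, 0 <= u x) -> rclosure u.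
Proof.
move=> hu u0; have [mfu iu] := hu.
have [g [g_nd g_cvg]] := @approximation _ (measurableTypeR R) R C measurable_circle
  (EFin \o u) (proj2 (measurable_EFinP _ _) mfu) (fun x _ => u0 x).
have gu x : C x -> g n x @[n --> \oo] --> u x.
  by move=> Cx; have /fine_cvgP[_] := g_cvg x Cx.
have gle n x : C x -> g n x <= u x.
  move=> Cx; rewrite -(cvg_lim (@Rhausdorff R) (gu x Cx)).
  apply: (@nondecreasing_cvgn_le _ (fun n => g n x)); last by apply/cvg_ex; eexists; exact: gu.
  by move=> m k mk; have /lefP := g_nd _ _ mk; exact.
apply: (rclosure_dominated (u_ := fun n => g n) hu _ _ iu).
- by move=> n; exact: rclosure_nnsfun.
- by apply: aeW => x; exact: gu.
- move=> n x Cx; have := gle n x Cx; have : 0 <= g n x by exact: fun_ge0.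
  nra.
Qed.

Lemma rclosure_rL2 u : rL2 u -> rclosure u.
Proof.
move=> hu; have [mfu iu] := hu.
have P v : measurable_fun C v -> (forall x, 0 <= v x <= `|u x|) -> rclosure v.
  move=> mfv v0; apply: rclosure_ge0; last by move=> x; case/andP: (v0 x).
  split => //; apply: (integrable_le _ iu); first exact: measurable_funX.
  move=> x _; have /andP[h1 h2] := v0 x.
  by rewrite ger0_norm ?sqr_ge0// -[leRHS]real_normK ?num_real// lerXn2r ?nnegrE.
have -> : u = fun x => Num.max (u x) 0 + -1 * Num.max (- u x) 0.
  by apply/funext => x; rewrite mulN1r /Num.max; case: ifP; case: ifP; lra.
apply: rclosureD; [|apply: rclosureZ]; apply: P.
- by apply: measurable_maxr => //; exact: measurable_cst.
- by move=> x; rewrite /Num.max; case: ifP; rewrite ?normr_ge0 ?lexx//=;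
    have := ler_norm (u x); lra.
- apply: measurable_maxr; last exact: measurable_cst.
  exact: measurableT_comp.
- move=> x; rewrite /Num.max; case: ifP; rewrite ?normr_ge0 ?lexx//=;
    have := ler_norm (- u x); rewrite normrN; lra.
Qed.

Lemma trig_closure_L2 f : in_L2 f -> trig_closure f.
Proof.
move=> /in_L2P[fr fi].
have := trig_closureD (rclosure_rL2 fr) (trig_closureZ ('i)%C (rclosure_rL2 fi)).
suff -> : (fun x => ((complex.Re (f x))%:C)%C + ('i)%C * ((complex.Im (f x))%:C)%C) = f by [].
apply/funext => x; case: (f x) => a b; apply: complexP;
  rewrite ?Re_add ?Im_add ?Re_mul ?Im_mul /=; ring.
Qed.

Theorem fourier_hilbert_basis : hilbert_basis (@fourier R).
Proof.
split; [exact: fourier_in_L2|exact: dotL2_fourier|move=> f hf].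
apply: parseval_of_approx => //; [exact: fourier_in_L2|exact: dotL2_fourier|].
move=> e e0; have [_ /(_ e e0)[P /trig_span[s [a [us ->]]] Pe]] := trig_closure_L2 hf.
by exists s, a.
Qed.

End parseval.

(** * Traces and diagonalizations *)

Section esum_theory.
Context {R : realType}.
Local Open Scope ereal_scope.

Lemma exchange_esum (T T' : choiceType) (a : T -> T' -> \bar R) :
  (forall i j, 0 <= a i j) ->
  \esum_(i in [set: T]) \esum_(j in [set: T']) a i j =
  \esum_(j in [set: T']) \esum_(i in [set: T]) a i j.
Proof.
move=> a0; rewrite !esum_esum//.
pose swap (p : T' * T) := (p.2, p.1).
apply: (@reindex_esum _ _ _ _ _ swap (fun k => a k.1 k.2)); split.
- by move=> [i j].
- by move=> [i j] [i' j'] _ _ [-> ->].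
- by move=> [i j] _; exists (j, i).
Qed.

(** Finite partial sums give one inequality; the same inequality for the factor 1 / c gives the
    other. *)
Lemma esumZl (T : choiceType) (c : R) (a : T -> \bar R) :
  (0 <= c)%R -> (forall i, 0 <= a i) ->
  \esum_(i in [set: T]) (c%:E * a i) = c%:E * \esum_(i in [set: T]) a i.
Proof.
have H (d : R) (b : T -> \bar R) : (0 <= d)%R -> (forall i, 0 <= b i) ->
    \esum_(i in [set: T]) (d%:E * b i) <= d%:E * \esum_(i in [set: T]) b i.
  move=> d0 b0; apply: ge_ereal_sup => _ [X [finX _] <-].
  rewrite fsbig_finite//= -ge0_sume_distrr//.
  rewrite lee_wpmul2l ?lee_fin//; apply: esum_ge; exists X => //.
  by rewrite fsbig_finite.
rewrite le_eqVlt => /predU1P[<-|c0] a0.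
  by rewrite mul0e esum1// => i _; rewrite mul0e.
apply/eqP; rewrite eq_le (H _ _ (ltW c0) a0) /=.
have := H c^-1%R (fun i => c%:E * a i); rewrite invr_ge0 ltW// => /(_ isT).
have ca0 i : 0 <= c%:E * a i by rewrite mule_ge0// lee_fin ltW.
move=> /(_ ca0).
under eq_esum do rewrite muleA -EFinM mulVf ?gt_eqF// mul1e.
move=> h; have := lee_wpmul2l (ltW c0 : 0 <= c%:E) h.
by rewrite muleA -EFinM divff ?gt_eqF// mul1e.
Qed.

End esum_theory.

Section heat_trace.
Context {R : realType}.
Implicit Types (e f g : int -> R -> R[i]) (lam m : int -> R).

Lemma hilbert_basis_nrm2 e k : hilbert_basis e -> sqnormL2 (e k) = 1%E.
Proof. by move=> [eL2 eo _]; rewrite sqnormL2E// /nrm2 eo eqxx. Qed.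

Lemma sqmod_dotL2C (f g : R -> R[i]) : in_L2 f -> in_L2 g ->
  sqmod (dotL2 f g) = sqmod (dotL2 g f).
Proof. by move=> hf hg; rewrite dotL2C// sqmod_conj. Qed.

Lemma esum_sqmod_dotL2 e (g : R -> R[i]) : hilbert_basis e -> in_L2 g ->
  (\esum_(j in [set: int]) (sqmod (dotL2 (e j) g))%:E = sqnormL2 g)%E.
Proof.
move=> [eL2 eo ep] hg; rewrite -ep//; apply: eq_esum => j _.
by rewrite sqmod_dotL2C.
Qed.

(** After exchanging the sums, the factor of each exponential is |e_k|^2 = 1, computed in the basis
    [f]. *)
Lemma heat_trace_spectral e lam f t : hilbert_basis e -> hilbert_basis f ->
  (\esum_(j in [set: int]) heat_form e lam t (f j) =
   \esum_(k in [set: int]) (expR (- (t * lam k)))%:E)%E.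
Proof.
move=> he hf; have [eL2 _ _] := he.
rewrite /heat_form exchange_esum; last first.
  by move=> i j; rewrite lee_fin mulr_ge0 ?expR_ge0 ?sqmod_ge0.
apply: eq_esum => k _; under eq_esum do rewrite EFinM.
rewrite esumZl ?expR_ge0//; last by move=> i; rewrite lee_fin sqmod_ge0.
by rewrite esum_sqmod_dotL2// hilbert_basis_nrm2// mule1.
Qed.

(* The squared moduli |<e_k, g_j>|^2 form a doubly stochastic matrix which
   vanishes when [lam k] differs from [m j]. *)
Lemma esum_eigenvalues e g lam m (F : R -> R) : hilbert_basis e -> hilbert_basis g ->
  (forall x, 0 <= F x) ->
  (forall k j, dotL2 (e k) (g j) != 0 -> lam k = m j) ->
  (\esum_(k in [set: int]) (F (lam k))%:E = \esum_(j in [set: int]) (F (m j))%:E)%E.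
Proof.
move=> he hg F0 lm; have [eL2 _ ep] := he; have [gL2 _ gp] := hg.
transitivity (\esum_(k in [set: int]) \esum_(j in [set: int])
    (F (lam k) * sqmod (dotL2 (e k) (g j)))%:E)%E.
  apply: eq_esum => k _; under eq_esum do rewrite EFinM.
  rewrite esumZl//; last by move=> i; rewrite lee_fin sqmod_ge0.
  by rewrite gp// hilbert_basis_nrm2// mule1.
rewrite exchange_esum; last by move=> i j; rewrite lee_fin mulr_ge0 ?sqmod_ge0.
apply: eq_esum => j _.
transitivity (\esum_(k in [set: int]) ((F (m j))%:E * (sqmod (dotL2 (e k) (g j)))%:E))%E.
  apply: eq_esum => k _; rewrite -EFinM.
  have [->|/lm ->//] := eqVneq (dotL2 (e k) (g j)) 0.
  by rewrite (_ : sqmod 0 = 0) ?mulr0//; apply/eqP; rewrite sqmod_eq0.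
rewrite esumZl//; last by move=> i; rewrite lee_fin sqmod_ge0.
by rewrite esum_sqmod_dotL2// hilbert_basis_nrm2// mule1.
Qed.

End heat_trace.

(** * The magnetic Laplacian and its separated solutions *)

Section differentiable_near.
Context {R : numFieldType} {V W : normedModType R}.

(** Both functions have the same little-o expansion at [p]. This transfers differentiability to
    partial derivatives whose formula is known only on an open set. *)
Lemma near_eq_differentiable (f g : V -> W) p :
  {near p, f =1 g} -> differentiable f p -> differentiable g p.
Proof.
move=> fg df; have fgp := nbhs_singleton fg.
have [cd /eqaddoP E] := (proj1 (diff_locallyP p f)) df.
have E' : g \o shift p = cst (g p) + 'd f p +o_ (0 : V) id.
  apply/eqaddoP => e e0; have := E e e0.
  have : \forall h \near (0 : V), f (h + p) = g (h + p).
    by have := near_shift 0 p (fun q => f q = g q); rewrite subr0 => <-.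
  apply: filterS2 => h /= fgh; rewrite !fctE /= fgh fgp; exact.
apply/diff_locallyP; rewrite (diff_unique cd E'); split => //.
Qed.

End differentiable_near.

(** * Gradients of real functions in the plane *)

Section plane_calculus.
Context {R : realType}.
Implicit Types (f g : R * R -> R) (p : R * R).

(** Differentiability accompanies the two partial derivatives because the chain rule along a curve
    requires it. *)
Definition has_grad f p (gx gy : R) :=
  [/\ differentiable f p, 'D_(1, 0) f p = gx & 'D_(0, 1) f p = gy].

Lemma has_gradP f p (gx gy : R) : has_grad f p gx gy ->
  is_derive p (1, 0) f gx /\ is_derive p (0, 1) f gy.
Proof. by move=> [df <- <-]; split; apply/derivableP/diff_derivable. Qed.

Lemma has_gradI f p (gx gy : R) : differentiable f p ->
  is_derive p (1, 0) f gx -> is_derive p (0, 1) f gy -> has_grad f p gx gy.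
Proof. by move=> df [_ dx] [_ dy]. Qed.

Lemma has_gradD f g p fx fy gx gy : has_grad f p fx fy -> has_grad g p gx gy ->
  has_grad (fun q => f q + g q) p (fx + gx) (fy + gy).
Proof.
move=> hf hg; have [fx' fy'] := has_gradP hf; have [gx' gy'] := has_gradP hg.
apply: has_gradI; [|exact: is_derive_add..].
by case: hf => hf _ _; case: hg => hg _ _; exact: differentiableD.
Qed.

Lemma has_gradN f p fx fy : has_grad f p fx fy ->
  has_grad (fun q => - f q) p (- fx) (- fy).
Proof.
move=> hf; have [fx' fy'] := has_gradP hf.
apply: has_gradI; [|exact: is_derive_opp..].
by case: hf => hf _ _; exact: differentiableN.
Qed.

Lemma has_gradM f g p fx fy gx gy : has_grad f p fx fy -> has_grad g p gx gy ->
  has_grad (fun q => f q * g q) p (f p * gx + g p * fx) (f p * gy + g p * fy).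
Proof.
move=> hf hg; have [fx' fy'] := has_gradP hf; have [gx' gy'] := has_gradP hg.
apply: has_gradI; [|exact: is_derive_mul..].
by case: hf => hf _ _; case: hg => hg _ _; exact: differentiableM.
Qed.

Lemma has_grad_comp (h : R -> R) (dh : R) f p fx fy : is_derive (f p) 1 h dh ->
  has_grad f p fx fy -> has_grad (fun q => h (f q)) p (dh * fx) (dh * fy).
Proof.
move=> hh hf; have [fx' fy'] := has_gradP hf.
apply: has_gradI; [|exact: is_derive_comp_real..].
case: hf => hf _ _; apply: (@differentiable_comp _ _ _ _ f h) => //.
by rewrite -derivable1_diffP; case: hh.
Qed.

Lemma has_grad_cst (c : R) p : has_grad (fun=> c) p 0 0.
Proof. by split; [exact: differentiable_cst|exact: derive_cst..]. Qed.

Lemma continuous_fstR : continuous (fst : R * R -> R).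
Proof. by move=> p; exact: cvg_fst. Qed.

Lemma continuous_sndR : continuous (snd : R * R -> R).
Proof. by move=> p; exact: cvg_snd. Qed.

Lemma has_grad_fst p : has_grad fst p 1 0.
Proof.
have d : differentiable (fst : R * R -> R) p.
  exact: linear_differentiable continuous_fstR.
by split=> //; rewrite deriveE// (diff_lin p continuous_fstR).
Qed.

Lemma has_grad_snd p : has_grad snd p 0 1.
Proof.
have d : differentiable (snd : R * R -> R) p.
  exact: linear_differentiable continuous_sndR.
by split=> //; rewrite deriveE// (diff_lin p continuous_sndR).
Qed.

Lemma has_grad_eq f p gx gy gx' gy' : has_grad f p gx gy -> gx = gx' -> gy = gy' ->
  has_grad f p gx' gy'.
Proof. by move=> ? <- <-. Qed.

Lemma is_derive_curve f (u w : R -> R) (t du dw fx fy : R) :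
  is_derive t 1 u du -> is_derive t 1 w dw -> has_grad f (u t, w t) fx fy ->
  is_derive t 1 (fun s => f (u s, w s)) (du * fx + dw * fy).
Proof.
move=> [u1 <-] [w1 <-] [df hx hy].
have du1 : differentiable u t := proj1 (derivable1_diffP u t) u1.
have dw1 : differentiable w t := proj1 (derivable1_diffP w t) w1.
have dp : differentiable (fun s => (u s, w s) : R * R) t by exact: differentiable_pair.
have d : differentiable (f \o (fun s => (u s, w s))) t by exact: differentiable_comp.
split; first by apply: diff_derivable; exact: d.
rewrite (deriveE _ d) diff_comp//= diff_pair// -hx -hy !deriveE//.
have L (x y : R) : x * 'd f (u t, w t) (1, 0) + y * 'd f (u t, w t) (0, 1) =
    'd f (u t, w t) (x *: (1, 0) + y *: (0, 1)) by rewrite linearD !linearZ.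
rewrite L.
congr ('d f _ _); rewrite -!deriveE//.
by congr (_, _); rewrite /= -![_ *: _]/(_ * _) ?mulr1 ?mulr0 ?addr0 ?add0r.
Qed.

End plane_calculus.

(** * The magnetic Laplacian in real and imaginary parts *)

Section magnetic.
Context {R : realType}.
Implicit Types (f g a b : R * R -> R) (p q : R * R) (nu : R).

Definition sqr_radius (p : R * R) : R := p.1 ^+ 2 + p.2 ^+ 2.
Local Notation rho := sqr_radius.

Definition grad_x f : R * R -> R := fun q => 'D_(1, 0) f q.
Definition grad_y f : R * R -> R := fun q => 'D_(0, 1) f q.

Lemma differentiable_has_grad f p : differentiable f p ->
  has_grad f p (grad_x f p) (grad_y f p).
Proof. by []. Qed.

Lemma has_grad_sqr_radius p : has_grad rho p (2 * p.1) (2 * p.2).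
Proof.
apply: has_grad_eq (has_gradD (has_gradM (has_grad_fst p) (has_grad_fst p))
  (has_gradM (has_grad_snd p) (has_grad_snd p))) _ _; ring.
Qed.

Lemma has_gradV f p fx fy : f p != 0 -> has_grad f p fx fy ->
  has_grad (fun q => (f q)^-1) p (- (f p) ^- 2 * fx) (- (f p) ^- 2 * fy).
Proof.
move=> f0 hf; apply: (has_grad_comp (h := GRing.inv)) => //.
split; first exact: (@derivableV _ _ (@id R)).
by rewrite (@deriveV _ _ (@id R))// derive_id; exact: mulr1.
Qed.

(** The diagonal entries are opposite and the other two are equal: away from 0, A_nu has neither
    divergence nor curl. *)
Lemma has_grad_AB nu p : rho p != 0 ->
  has_grad (fun q => (AB_potential nu q).1) p
    (2 * nu * p.1 * p.2 / rho p ^+ 2) (nu * (p.2 ^+ 2 - p.1 ^+ 2) / rho p ^+ 2) /\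
  has_grad (fun q => (AB_potential nu q).2) p
    (nu * (p.2 ^+ 2 - p.1 ^+ 2) / rho p ^+ 2) (- (2 * nu * p.1 * p.2 / rho p ^+ 2)).
Proof.
move=> r0; have hV := has_gradM (has_grad_cst nu p) (has_gradV r0 (has_grad_sqr_radius p)).
rewrite /AB_potential /=; split.
  apply: has_grad_eq (has_gradM hV (has_gradN (has_grad_snd p))) _ _;
  by move: r0; rewrite /rho => r0; field.
apply: has_grad_eq (has_gradM hV (has_grad_fst p)) _ _;
  by move: r0; rewrite /rho => r0; field.
Qed.

(** This is - Delta v + 2 i A . grad v + |A|^2 v, the term in div A being zero, with A . grad = (nu
    / rho) d_theta. It is split into components because [cderive] differentiates them separately. *)
Lemma magnetic_laplacianE nu (v : R * R -> R[i]) p (a := fun q => complex.Re (v q))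
  (b := fun q => complex.Im (v q)) : 0 < rho p ->
  cdifferentiable v p -> cdifferentiable (dx v) p -> cdifferentiable (dy v) p ->
  magnetic_laplacian nu v p =
  ((- (grad_x (grad_x a) p + grad_y (grad_y a) p)
    + 2 * nu / rho p * (p.2 * grad_x b p - p.1 * grad_y b p) + nu ^+ 2 / rho p * a p) +i*
   (- (grad_x (grad_x b) p + grad_y (grad_y b) p)
    - 2 * nu / rho p * (p.2 * grad_x a p - p.1 * grad_y a p) + nu ^+ 2 / rho p * b p))%C.
Proof.
move=> r0 [da db] [dax dbx] [day dby].
have rn0 : rho p != 0 by rewrite gt_eqF.
pose A1 q := (AB_potential nu q).1; pose A2 q := (AB_potential nu q).2.
have [hA1 hA2] := has_grad_AB nu rn0.
have eX q : magDx nu v q = ((grad_x b q - A1 q * a q) +i* (- grad_x a q - A1 q * b q))%C.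
  by rewrite /magDx /dx /cderive -/(grad_x a q) -/(grad_x b q) -/(A1 q); apply: complexP;
    rewrite !(Re_add, Im_add, Re_opp, Im_opp, Re_mul, Im_mul) /=; rewrite /a /b; ring.
have eY q : magDy nu v q = ((grad_y b q - A2 q * a q) +i* (- grad_y a q - A2 q * b q))%C.
  by rewrite /magDy /dy /cderive -/(grad_y a q) -/(grad_y b q) -/(A2 q); apply: complexP;
    rewrite !(Re_add, Im_add, Re_opp, Im_opp, Re_mul, Im_mul) /=; rewrite /a /b; ring.
have ha : has_grad a p (grad_x a p) (grad_y a p) := differentiable_has_grad da.
have hb : has_grad b p (grad_x b p) (grad_y b p) := differentiable_has_grad db.
have hax : has_grad (grad_x a) p (grad_x (grad_x a) p) (grad_y (grad_x a) p) :=
  differentiable_has_grad dax.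
have hbx : has_grad (grad_x b) p (grad_x (grad_x b) p) (grad_y (grad_x b) p) :=
  differentiable_has_grad dbx.
have hay : has_grad (grad_y a) p (grad_x (grad_y a) p) (grad_y (grad_y a) p) :=
  differentiable_has_grad day.
have hby : has_grad (grad_y b) p (grad_x (grad_y b) p) (grad_y (grad_y b) p) :=
  differentiable_has_grad dby.
have [_ X1 _] := has_gradD hbx (has_gradN (has_gradM hA1 ha)).
have [_ X2 _] := has_gradD (has_gradN hax) (has_gradN (has_gradM hA1 hb)).
have [_ _ Y1] := has_gradD hby (has_gradN (has_gradM hA2 ha)).
have [_ _ Y2] := has_gradD (has_gradN hay) (has_gradN (has_gradM hA2 hb)).
have RX : (fun q => complex.Re (magDx nu v q)) = (fun q => grad_x b q - A1 q * a q).
  by apply/funext => q; rewrite eX.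
have IX : (fun q => complex.Im (magDx nu v q)) = (fun q => - grad_x a q - A1 q * b q).
  by apply/funext => q; rewrite eX.
have RY : (fun q => complex.Re (magDy nu v q)) = (fun q => grad_y b q - A2 q * a q).
  by apply/funext => q; rewrite eY.
have IY : (fun q => complex.Im (magDy nu v q)) = (fun q => - grad_y a q - A2 q * b q).
  by apply/funext => q; rewrite eY.
have DX : dx (magDx nu v) p = (_ +i* _)%C :=
  f_equal2 (@Complex R) (etrans (congr1 (fun h => 'D_(1, 0) h p) RX) X1)
    (etrans (congr1 (fun h => 'D_(1, 0) h p) IX) X2).
have DY : dy (magDy nu v) p = (_ +i* _)%C :=
  f_equal2 (@Complex R) (etrans (congr1 (fun h => 'D_(0, 1) h p) RY) Y1)
    (etrans (congr1 (fun h => 'D_(0, 1) h p) IY) Y2).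
rewrite /magnetic_laplacian {1}/magDx {1}/magDy DX DY.
have r0' : p.1 ^+ 2 + p.2 ^+ 2 != 0 by [].
rewrite eX eY /A1 /A2 /AB_potential /= -/(a p) -/(b p) /rho.
move: (grad_x (grad_x a) p) (grad_y (grad_y a) p) (grad_x (grad_x b) p) (grad_y (grad_y b) p)
  (grad_x a p) (grad_y a p) (grad_x b p) (grad_y b p) (a p) (b p) => *.
by apply: complexP; rewrite !(Re_add, Im_add, Re_opp, Im_opp, Re_mul, Im_mul) /=; field.
Qed.

End magnetic.

(** * Separated solutions: regularity and equation *)

Section planar_solutions.
Context {R : realType}.
Implicit Types (f g a b : R * R -> R) (p q : R * R) (nu m k : R).
Local Notation rho := sqr_radius.

(* W = a + i b satisfies r d_r W = m W and d_theta W = i k W, as |z|^m (z/|z|)^k does. *)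
Definition planar_wave m k a b := forall p, 0 < rho p ->
  has_grad a p ((m * p.1 * a p + k * p.2 * b p) / rho p)
               ((m * p.2 * a p - k * p.1 * b p) / rho p) /\
  has_grad b p ((m * p.1 * b p - k * p.2 * a p) / rho p)
               ((m * p.2 * b p + k * p.1 * a p) / rho p).

(* This class is closed under partial derivatives, whence the smoothness of [a] and [b]. *)
Inductive wave_expr a b : (R * R -> R) -> Prop :=
| wave_cst c : wave_expr a b (fun=> c)
| wave_fst : wave_expr a b fst
| wave_snd : wave_expr a b snd
| wave_inv : wave_expr a b (fun q => (rho q)^-1)
| wave_re : wave_expr a b a
| wave_im : wave_expr a b b
| wave_add f g : wave_expr a b f -> wave_expr a b g -> wave_expr a b (fun q => f q + g q)
| wave_mul f g : wave_expr a b f -> wave_expr a b g -> wave_expr a b (fun q => f q * g q).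

Lemma wave_opp a b f : wave_expr a b f -> wave_expr a b (fun q => - f q).
Proof.
move=> hf; under eq_fun do rewrite -mulN1r.
by apply: wave_mul => //; exact: wave_cst.
Qed.

Lemma wave_grad m k a b f : planar_wave m k a b -> wave_expr a b f ->
  exists fx fy, [/\ wave_expr a b fx, wave_expr a b fy &
    forall p, 0 < rho p -> has_grad f p (fx p) (fy p)].
Proof.
move=> hab; elim=> {f}.
- move=> c; exists (fun=> 0), (fun=> 0); split; try exact: wave_cst.
  by move=> p _; exact: has_grad_cst.
- exists (fun=> 1), (fun=> 0); split; try exact: wave_cst.
  by move=> p _; exact: has_grad_fst.
- exists (fun=> 0), (fun=> 1); split; try exact: wave_cst.
  by move=> p _; exact: has_grad_snd.
- exists (fun q => ((rho q)^-1 * (rho q)^-1) * (-2 * q.1)),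
         (fun q => ((rho q)^-1 * (rho q)^-1) * (-2 * q.2)); split.
  + by apply: wave_mul; apply: wave_mul; constructor.
  + by apply: wave_mul; apply: wave_mul; constructor.
  + move=> p p0; have pn0 : rho p != 0 by rewrite gt_eqF.
    apply: has_grad_eq (has_gradV pn0 (has_grad_sqr_radius p)) _ _; by field.
- exists (fun p => (m * p.1 * a p + k * p.2 * b p) / rho p),
    (fun p => (m * p.2 * a p - k * p.1 * b p) / rho p); split.
  + by apply: wave_mul; [apply: wave_add; apply: wave_mul; try apply: wave_mul|]; constructor.
  + apply: wave_mul; last by constructor.
    by apply: wave_add; [|apply: wave_opp]; apply: wave_mul; try apply: wave_mul; constructor.
  + by move=> p p0; have [] := hab p p0.
- exists (fun p => (m * p.1 * b p - k * p.2 * a p) / rho p),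
    (fun p => (m * p.2 * b p + k * p.1 * a p) / rho p); split.
  + apply: wave_mul; last by constructor.
    by apply: wave_add; [|apply: wave_opp]; apply: wave_mul; try apply: wave_mul; constructor.
  + by apply: wave_mul; [apply: wave_add; apply: wave_mul; try apply: wave_mul|]; constructor.
  + by move=> p p0; have [] := hab p p0.
- move=> f g wf [fx [fy [hfx hfy hf]]] wg [gx [gy [hgx hgy hg]]].
  exists (fun q => fx q + gx q), (fun q => fy q + gy q); split; try exact: wave_add.
  by move=> p p0; apply: has_gradD; [exact: hf|exact: hg].
- move=> f g wf [fx [fy [hfx hfy hf]]] wg [gx [gy [hgx hgy hg]]].
  exists (fun q => f q * gx q + g q * fx q), (fun q => f q * gy q + g q * fy q).
  split; try by apply: wave_add; exact: wave_mul.
  by move=> p p0; apply: has_gradM; [exact: hf|exact: hg].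
Qed.

Lemma near_sqr_radius_gt0 p : 0 < rho p -> \forall q \near p, 0 < rho q.
Proof.
move=> p0; have [d _ _] := has_grad_sqr_radius p.
exact: (cvgr_gt _ (differentiable_continuous d)).
Qed.

Lemma wave_C2 m k a b : planar_wave m k a b ->
  C2_on (@punctured_disk R) (fun p => (a p +i* b p)%C).
Proof.
move=> hab p /= /andP[p0 _].
have G f : wave_expr a b f -> exists fx fy, [/\ wave_expr a b fx, wave_expr a b fy,
    forall q, 0 < rho q -> has_grad f q (fx q) (fy q),
    {near p, fx =1 (fun q => 'D_(1, 0) f q)} &
    {near p, fy =1 (fun q => 'D_(0, 1) f q)}].
  move=> /(wave_grad hab)[fx [fy [hfx hfy hf]]]; exists fx, fy; split => //.
    by apply: filterS (near_sqr_radius_gt0 p0) => q q0; have [_ ->] := hf q q0.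
  by apply: filterS (near_sqr_radius_gt0 p0) => q q0; have [_ _ ->] := hf q q0.
have D f : wave_expr a b f -> differentiable f p.
  by move=> /G[fx [fy [_ _ /(_ p p0)[]]]].
have D1 f : wave_expr a b f -> differentiable (fun q => 'D_(1, 0) f q : R) p /\
    differentiable (fun q => 'D_(0, 1) f q : R) p.
  move=> /G[fx [fy [hfx hfy _ ex ey]]].
  by split; [apply: near_eq_differentiable ex _|apply: near_eq_differentiable ey _]; exact: D.
have D2 f : wave_expr a b f ->
   [/\ {for p, continuous (fun q => 'D_(1, 0) (fun q => 'D_(1, 0) f q : R) q : R)},
     {for p, continuous (fun q => 'D_(1, 0) (fun q => 'D_(0, 1) f q : R) q : R)},
     {for p, continuous (fun q => 'D_(0, 1) (fun q => 'D_(1, 0) f q : R) q : R)} &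
     {for p, continuous (fun q => 'D_(0, 1) (fun q => 'D_(0, 1) f q : R) q : R)}].
  move=> hf.
  (* [h] will be a partial derivative of [f], which coincides with an expression [g] only where rho
     > 0; as this set is open, the next derivatives coincide there as well. *)
  have K (w : R * R) (g h : R * R -> R) : wave_expr a b g ->
      (forall q, 0 < rho q -> g q = h q) ->
      (w = (1, 0) \/ w = (0, 1)) -> {for p, continuous (fun q => 'D_w h q : R)}.
    move=> wg gh hw; have [gx [gy [hgx hgy hg]]] := wave_grad hab wg.
    apply: differentiable_continuous.
    have E q : 0 < rho q -> 'D_w h q = 'D_w g q.
      move=> q0; apply: near_eq_derive.
      by apply: filterS (near_sqr_radius_gt0 q0) => q' q'0; rewrite gh.
    have [d10 d01] := D1 _ wg.
    case: hw E => -> E; [apply: near_eq_differentiable d10|apply: near_eq_differentiable d01];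
    by apply: filterS (near_sqr_radius_gt0 p0) => q q0; rewrite E.
  have [fx [fy [hfx hfy hf']]] := wave_grad hab hf.
  split.
  - by apply: (K _ fx) => //; [move=> q q0; have [_ ->] := hf' q q0|left].
  - by apply: (K _ fy) => //; [move=> q q0; have [_ _ ->] := hf' q q0|left].
  - by apply: (K _ fx) => //; [move=> q q0; have [_ ->] := hf' q q0|right].
  - by apply: (K _ fy) => //; [move=> q q0; have [_ _ ->] := hf' q q0|right].
have wa := wave_re a b; have wb := wave_im a b.
have [a1 a2] := D1 _ wa; have [b1 b2] := D1 _ wb.
have [a3 a4 a5 a6] := D2 _ wa; have [b3 b4 b5 b6] := D2 _ wb.
split.
- exact: (conj (D _ wa) (D _ wb)).
- exact: (conj (conj a1 b1) (conj a2 b2)).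
- exact: (conj (conj a3 b3) (conj a4 b4)).
- exact: (conj (conj a5 b5) (conj a6 b6)).
Qed.

(** In polar coordinates r^2 (D - A_nu)^2 is (D_theta - nu)^2 - (r d_r)^2, which multiplies the wave
    by (k - nu)^2 - m^2. *)
Lemma wave_magnetic_laplacian (m : R) (k : int) nu a b : planar_wave m k%:~R a b ->
  m ^+ 2 = (k%:~R - nu) ^+ 2 ->
  forall p, punctured_disk p -> magnetic_laplacian nu (fun p => (a p +i* b p)%C) p = 0.
Proof.
move=> hab mk p pU; have [dv [dxv dyv] _ _] := wave_C2 hab pU.
have p0 : 0 < rho p by case/andP: pU.
have rn0 : rho p != 0 by rewrite gt_eqF.
have rn0' : p.1 ^+ 2 + p.2 ^+ 2 != 0 by [].
rewrite magnetic_laplacianE//=.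
have [ha hb] := hab p p0.
have hV := has_gradV rn0 (has_grad_sqr_radius p).
have hx := has_grad_fst p; have hy := has_grad_snd p.
have hm c := has_grad_cst (c : R) p.
have near_eq (f g : R * R -> R) w : (forall q, 0 < rho q -> f q = g q) ->
    'D_w f p = 'D_w g p.
  by move=> fg; apply: near_eq_derive; apply: filterS (near_sqr_radius_gt0 p0) => q; exact: fg.
have H1 := has_gradM (has_gradD (has_gradM (has_gradM (hm m) hx) ha)
  (has_gradM (has_gradM (hm k%:~R) hy) hb)) hV.
have H2 := has_gradM (has_gradD (has_gradM (has_gradM (hm m) hy) ha)
  (has_gradN (has_gradM (has_gradM (hm k%:~R) hx) hb))) hV.
have H3 := has_gradM (has_gradD (has_gradM (has_gradM (hm m) hx) hb)
  (has_gradN (has_gradM (has_gradM (hm k%:~R) hy) ha))) hV.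
have H4 := has_gradM (has_gradD (has_gradM (has_gradM (hm m) hy) hb)
  (has_gradM (has_gradM (hm k%:~R) hx) ha)) hV.
case: H1 H2 H3 H4 => _ H1 _ [_ _ H2] [_ H3 _] [_ _ H4].
have fax q : 0 < rho q -> grad_x a q = (m * q.1 * a q + k%:~R * q.2 * b q) / rho q.
  by move=> q0; have [[]] := hab q q0.
have fay q : 0 < rho q -> grad_y a q = (m * q.2 * a q - k%:~R * q.1 * b q) / rho q.
  by move=> q0; have [[]] := hab q q0.
have fbx q : 0 < rho q -> grad_x b q = (m * q.1 * b q - k%:~R * q.2 * a q) / rho q.
  by move=> q0; have [_ []] := hab q q0.
have fby q : 0 < rho q -> grad_y b q = (m * q.2 * b q + k%:~R * q.1 * a q) / rho q.
  by move=> q0; have [_ []] := hab q q0.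
have E1 : grad_x (grad_x a) p = _ := etrans (near_eq (grad_x a) _ (1, 0) fax) H1.
have E2 : grad_y (grad_y a) p = _ := etrans (near_eq (grad_y a) _ (0, 1) fay) H2.
have E3 : grad_x (grad_x b) p = _ := etrans (near_eq (grad_x b) _ (1, 0) fbx) H3.
have E4 : grad_y (grad_y b) p = _ := etrans (near_eq (grad_y b) _ (0, 1) fby) H4.
rewrite E1 E2 E3 E4.
rewrite !fax// !fay// !fbx// !fby//=.
have {}mk : m ^+ 2 = k%:~R ^+ 2 - 2 * k%:~R * nu + nu ^+ 2 by rewrite mk; ring.
apply: complexP => /=.
  transitivity ((k%:~R ^+ 2 - 2 * k%:~R * nu + nu ^+ 2 - m ^+ 2) * a p / rho p).
    by rewrite /sqr_radius; field.
  by rewrite mk subrr !mul0r.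
transitivity ((k%:~R ^+ 2 - 2 * k%:~R * nu + nu ^+ 2 - m ^+ 2) * b p / rho p).
  by rewrite /sqr_radius; field.
by rewrite mk subrr !mul0r.
Qed.

End planar_solutions.

(** * Eigenfunctions of the Dirichlet-to-Neumann operator *)

Section eigenfunctions.
Context {R : realType}.
Implicit Types (p : R * R) (nu : R).
Let mu := @lebesgue_measure R.
Let C := @circle R.
Local Notation rho := sqr_radius.

Definition rpow (m r : R) : R := expR (m * ln r).

Lemma rpowD1 m r : 0 < r -> rpow (m + 1) r = rpow m r * r.
Proof. by move=> r0; rewrite /rpow mulrDl mul1r expRD lnK. Qed.

Lemma is_derive_rpow (m r : R) : 0 < r -> is_derive r 1 (rpow m) (m / r * rpow m r).
Proof.
move=> r0; have h := is_derive_mulc m (is_derive1_ln r0).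
have := is_derive_comp_real (f := fun y => m * ln y) (is_derive_expR (m * ln r)) h.
by rewrite mulrC.
Qed.

Lemma sqr_radius_polar (r theta : R) : rho (r * cos theta, r * sin theta) = r ^+ 2.
Proof. by rewrite /sqr_radius /= !exprMn -mulrDr cos2Dsin2 mulr1. Qed.

(** Start from rho^(m / 2) = r^m; multiplication by x + i y raises both the frequency and the radial
    exponent by one. The induction hypothesis is thus used at m - 1, with [m] kept general. *)
Lemma planar_wave_nat (n : nat) (m : R) : exists a b, planar_wave m n%:R a b /\
  forall r theta, 0 < r ->
    a (r * cos theta, r * sin theta) = rpow m r * cos (n%:R * theta) /\
    b (r * cos theta, r * sin theta) = rpow m r * sin (n%:R * theta).
Proof.
elim: n m => [|n ih] m.
  exists (fun p => rpow (m / 2) (rho p)), (fun=> 0); split.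
    move=> p p0; have rn0 : rho p != 0 by rewrite gt_eqF.
    split; last by apply: has_grad_eq (has_grad_cst 0 p) _ _; rewrite /=; field.
    apply: has_grad_eq (has_grad_comp (is_derive_rpow (m / 2) p0) (has_grad_sqr_radius p)) _ _ =>
      /=; by field.
  move=> r theta r0; rewrite mul0r cos0 sin0 mulr0 mulr1; split => //.
  by rewrite sqr_radius_polar /rpow lnXn// -mulr_natr; congr expR; field.
have [a [b [hab pab]]] := ih (m - 1).
exists (fun p => p.1 * a p - p.2 * b p), (fun p => p.2 * a p + p.1 * b p); split.
  move=> p p0; have rn0 : rho p != 0 by rewrite gt_eqF.
  have rn0' : p.1 ^+ 2 + p.2 ^+ 2 != 0 by [].
  have [ha hb] := hab p p0; have hx := has_grad_fst p; have hy := has_grad_snd p.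
  rewrite -[n.+1]addn1 natrD; split.
    apply: has_grad_eq (has_gradD (has_gradM hx ha) (has_gradN (has_gradM hy hb))) _ _;
    by rewrite /sqr_radius; field.
  apply: has_grad_eq (has_gradD (has_gradM hy ha) (has_gradM hx hb)) _ _;
  by rewrite /sqr_radius; field.
move=> r theta r0 /=; have [-> ->] := pab r theta r0.
have -> : rpow m r = rpow (m - 1) r * r by rewrite -rpowD1// subrK.
rewrite -[n.+1]addn1 natrD mulrDl mul1r cosD sinD; split; ring.
Qed.

Lemma planar_wave_int (k : int) (m : R) : exists a b, planar_wave m k%:~R a b /\
  forall r theta, 0 < r ->
    a (r * cos theta, r * sin theta) = rpow m r * cos (k%:~R * theta) /\
    b (r * cos theta, r * sin theta) = rpow m r * sin (k%:~R * theta).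
Proof.
case: k => n; first exact: planar_wave_nat.
have [a [b [hab pab]]] := planar_wave_nat n.+1 m.
(* Complex conjugation reverses the sign of the frequency. *)
rewrite NegzE mulrNz -pmulrn; exists a, (fun p => - b p); split.
  move=> p p0; have [ha hb] := hab p p0; split.
    by apply: has_grad_eq ha _ _; congr (_ / _); ring.
  by apply: has_grad_eq (has_gradN hb) _ _; rewrite -mulNr; congr (_ / _); ring.
move=> r theta r0; have [-> ->] := pab r theta r0.
by rewrite mulNr cosN sinN mulrN.
Qed.

Lemma Re_realM (x : R) (z : R[i]) : complex.Re ((x%:C)%C * z) = x * complex.Re z.
Proof. by case: z => a b; rewrite /= mul0r subr0. Qed.

Lemma Im_realM (x : R) (z : R[i]) : complex.Im ((x%:C)%C * z) = x * complex.Im z.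
Proof. by case: z => a b; rewrite /= mul0r addr0. Qed.

Lemma nrm2_scale_fourier (c : R[i]) k : sqnormL2 (fun x => c * fourier k x) = (sqmod c)%:E.
Proof.
rewrite sqnormL2E; last exact/in_L2Z/fourier_in_L2.
rewrite nrm2E; under eq_Rintegral do rewrite sqmodM sqmod_fourier.
by rewrite Rintegral_circle_cst -mulrA mulVf ?mulr1// gt_eqF ?twopi_gt0.
Qed.

Lemma DtN_fourier nu (k : int) :
  DtN nu (fourier k) (fun x => ((`|k%:~R - nu| : R)%:C)%C * fourier k x).
Proof.
set m : R := `|k%:~R - nu|.
split; [exact: fourier_in_L2|exact/in_L2Z/fourier_in_L2|].
have [a0 [b0 [hab0 pab0]]] := planar_wave_int k m.
pose s : R := (Num.sqrt (2 * pi))^-1.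
pose a p := s * a0 p; pose b p := s * b0 p.
have hab : planar_wave m k%:~R a b.
  move=> p p0; have [ha hb] := hab0 p p0; rewrite /a /b.
  split; [apply: has_grad_eq (has_gradM (has_grad_cst s p) ha) _ _|
          apply: has_grad_eq (has_gradM (has_grad_cst s p) hb) _ _];
  by rewrite mulr0 addr0 mulrA; congr (_ / _); ring.
have pv r theta : 0 < r -> polar (fun p => (a p +i* b p)%C) r theta =
    ((rpow m r)%:C)%C * fourier k theta.
  move=> r0; have [e1 e2] := pab0 r theta r0.
  rewrite /polar /a /b e1 e2 /fourier; apply: complexP;
  by rewrite !(Re_mul, Im_mul) /= -/s; ring.
have rv r theta : 0 < r -> radial_derivative (fun p => (a p +i* b p)%C) r theta =
    ((m / r * rpow m r)%:C)%C * fourier k theta.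
  move=> r0; rewrite /radial_derivative /cderive.
  have P : \forall q \near r, 0 < q by exact: (cvgr_gt r cvg_id).
  have D (f : R -> R) (c : R) : (forall q, 0 < q -> f q = rpow m q * c) ->
    'D_1 f r = m / r * rpow m r * c.
    move=> fc; rewrite (@near_eq_derive _ _ _ _ (fun q => c * rpow m q)).
      have [_ ->] := is_derive_mulc c (is_derive_rpow m r0); exact: mulrC.
    by apply: filterS P => q q0; rewrite fc// mulrC.
  rewrite (D _ (complex.Re (fourier k theta))); last first.
    by move=> q q0; rewrite pv// Re_realM.
  rewrite (D _ (complex.Im (fourier k theta))); last first.
    by move=> q q0; rewrite pv// Im_realM.
  by apply: complexP; rewrite ?Re_realM ?Im_realM.
have cont_rpow : rpow m r @[r --> (1 : R)] --> rpow m 1.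
  apply: differentiable_continuous; rewrite -derivable1_diffP.
  by have [] := is_derive_rpow m (@ltr01 R).
exists (fun p => (a p +i* b p)%C); split.
- exact: wave_C2 hab.
- apply: (wave_magnetic_laplacian hab).
  by rewrite /m real_normK ?num_real.
(* The mode at radius r is r^m times that of [fourier k], and r^m <= 1 on ]0, 1[ since m >= 0: here
   the sign in m = + |k - nu| matters. *)
- move=> j; exists (sqmod ((((2 * pi)^-1)%:C)%C * integral_circle (fun theta => fourier k theta *
  (cos (j%:~R * theta) -i* sin (j%:~R * theta))%C))).
  have r1 : \forall r \near (0 : R)^'+, 0 < r < 1.
    have h1 : \forall r \near (0 : R)^'+, 0 < r by exact: nbhs_right_gt.
    have h2 : \forall r \near (0 : R)^'+, r < 1 by exact: nbhs_right_lt.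
    by apply: filterS2 h1 h2 => r -> ->.
  apply: filterS r1 => r /andP[r0 r1].
  rewrite /angular_mode.
  have -> : integral_circle (fun theta => polar (fun p => (a p +i* b p)%C) r theta *
      (cos (j%:~R * theta) -i* sin (j%:~R * theta))%C) =
    ((rpow m r)%:C)%C * integral_circle (fun theta => fourier k theta *
      (cos (j%:~R * theta) -i* sin (j%:~R * theta))%C).
    rewrite -integral_circleZ; last exact: (dot_cintegrable (fourier_in_L2 k) (cis_in_L2 j%:~R)).
    by congr integral_circle; apply/funext => x; rewrite pv// mulrA.
  rewrite mulrCA [leLHS]sqmodM ler_piMl ?sqmod_ge0// sqmod_real.
  rewrite exprn_ile1 ?expR_ge0// -[leRHS]expR0 ler_expR.
  by rewrite mulr_ge0_le0 ?normr_ge0// ln_le0// ltW.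
(* [fourier k] has norm one, so the L^2 distance reduces to a number. *)
- have E : \forall r \near (1 : R)^'-, ((rpow m r - 1) ^+ 2)%:E =
      sqnormL2 (fun theta => polar (fun p => (a p +i* b p)%C) r theta - fourier k theta).
    have r0 : \forall r \near (1 : R)^'-, 0 < r by exact: nbhs_left_gt.
    apply: filterS r0 => r r0.
    rewrite -sqmod_real -(nrm2_scale_fourier _ k); congr sqnormL2; apply/funext => x.
    by rewrite pv// rmorphB mulrBl mul1r.
  apply: cvg_trans (near_eq_cvg E) _.
  apply: cvg_EFin; first exact: nearW.
  have -> : (0 : R) = (rpow m 1 - 1) ^+ 2 by rewrite /rpow ln1 mulr0 expR0 subrr expr0n.
  apply: cvg_at_left_filter; rewrite !expr2.
  by apply: cvgM; apply: cvgB; try exact: cvg_cst; exact: cont_rpow.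
- have E : \forall r \near (1 : R)^'-, ((m / r * rpow m r - m) ^+ 2)%:E =
      sqnormL2 (fun theta => radial_derivative (fun p => (a p +i* b p)%C) r theta - ((m)%:C)%C *
        fourier k theta).
    have r0 : \forall r \near (1 : R)^'-, 0 < r by exact: nbhs_left_gt.
    apply: filterS r0 => r r0.
    rewrite -sqmod_real -(nrm2_scale_fourier _ k); congr sqnormL2; apply/funext => x.
    by rewrite rv// rmorphB mulrBl.
  apply: cvg_trans (near_eq_cvg E) _.
  apply: cvg_EFin; first exact: nearW.
  have -> : (0 : R) = (m / 1 * rpow m 1 - m) ^+ 2.
    by rewrite /rpow ln1 mulr0 expR0 divr1 mulr1 subrr expr0n.
  apply: cvg_at_left_filter; rewrite !expr2.
  apply: cvgM; apply: cvgB; try exact: cvg_cst; apply: cvgM; try exact: cont_rpow;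
  by apply: cvgM; [exact: cvg_cst|apply: cvgV => //; exact: oner_neq0].
Qed.

End eigenfunctions.

(** * Angular modes of the solutions *)

Section euler_equation.
Context {R : realType}.

Lemma is_derive_le (g dg : R -> R) (d : R) :
  (forall x : R, 0 < x < d -> is_derive x 1 g (dg x)) ->
  (forall x, 0 < x < d -> 0 <= dg x) ->
  forall x y, 0 < x -> x <= y -> y < d -> g x <= g y.
Proof.
move=> hg dg0 x y x0 xy yd.
have H z : x <= z <= y -> is_derive z 1 g (dg z).
  by move=> /andP[xz zy]; apply: hg; rewrite (lt_le_trans x0)//= (le_lt_trans zy).
have H' z : z \in `]x, y[ -> is_derive z 1 g (dg z).
  by rewrite in_itv /= => /andP[xz zy]; apply: H; rewrite !ltW.
have cW : {within `[x, y], continuous g}.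
  by apply: derivable_within_continuous => z; rewrite in_itv /= => zi; have [] := H z zi.
have [c cxy e] := MVT_segment xy H' cW.
rewrite -subr_ge0 e mulr_ge0 ?subr_ge0// dg0//.
by move: cxy; rewrite in_itv /= => /andP[xc cy]; rewrite (lt_le_trans x0)//= (le_lt_trans cy).
Qed.

Lemma is_derive_cst_itv (g : R -> R) (d : R) :
  (forall x : R, 0 < x < d -> is_derive x 1 g 0) ->
  forall x y, 0 < x < d -> 0 < y < d -> g x = g y.
Proof.
move=> hg.
have H x y : 0 < x -> x <= y -> y < d -> g x = g y.
  move=> x0 xy yd; apply/eqP; rewrite eq_le; apply/andP; split.
    exact: (is_derive_le hg).
  rewrite -lerN2; apply: (@is_derive_le (fun x => - g x) (fun=> 0) d) => // z zd.
  by rewrite -oppr0; apply: is_derive_opp; exact: hg.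
move=> x y /andP[x0 xd] /andP[y0 yd].
by have [xy|/ltW yx] := leP x y; [exact: H|apply/esym; exact: H].
Qed.

(** The function g = r^m (F + 2 K) - c ln r has derivative (2 m / r) r^m (F + K) >= 0, so g (d / 2)
    bounds it on ]0, d / 2]. But its first term is nonnegative and - c ln r tends to +oo at 0. The
    logarithmic case m = 0 is included. *)
Lemma euler_singular_unbounded (F F1 : R -> R) (m c K d : R) : 0 <= m -> 0 < c -> 0 < d ->
  (forall r : R, 0 < r < d -> is_derive r 1 F (F1 r / r)) ->
  (forall r, 0 < r < d -> (F1 r - m * F r) * rpow m r = c) ->
  (forall r, 0 < r < d -> `|F r| <= K) -> False.
Proof.
move=> m0 c0 d0 dF Fc FK.
pose g r := rpow m r * (F r + 2 * K) - c * ln r.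
have K0 : 0 <= K by apply: le_trans (FK (d / 2) _) => //; apply/andP; split; lra.
have dg (r : R) : 0 < r < d -> is_derive r 1 g (2 * m / r * rpow m r * (F r + K)).
  move=> rd; have /andP[r0 _] := rd; have rn0 : r != 0 by rewrite gt_eqF.
  have h1 := is_derive_rpow m r0; have h2 := dF r rd.
  have h3 : is_derive r 1 (fun _ : R => 2 * K : R) 0 by exact: is_derive_cst.
  have h4 := is_derive_add h2 h3.
  have h5 := is_derive_mul h1 h4.
  have h6 := is_derive_sub h5 (is_derive_mulc c (is_derive1_ln r0)).
  have -> : 2 * m / r * rpow m r * (F r + K) = rpow m r * (F1 r / r + 0) + (F r + 2 * K) * (m / r
    * rpow m r) - c * r^-1.
    by rewrite -(Fc r rd); field.
  exact: h6.
have g0 r : 0 < r < d -> 0 <= 2 * m / r * rpow m r * (F r + K).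
  move=> rd; have /andP[r0 _] := rd; have := FK r rd; rewrite ler_norml => /andP[Fr _].
  by rewrite mulr_ge0 ?mulr_ge0 ?invr_ge0 ?expR_ge0 ?(ltW r0)//; lra.
have gm := is_derive_le dg g0.
(* Chosen so that exp (- L) < r0 and c L > |g r0|. *)
pose r0 := d / 2; pose L := `|ln r0| + `|g r0| / c + 1.
have r00 : 0 < r0 by rewrite /r0 divr_gt0.
have L1 : expR (- L) < r0.
  rewrite -[ltRHS]lnK// ltr_expR /L; have := ler_norm (- ln r0); rewrite normrN.
  have : 0 <= `|g r0| / c by rewrite divr_ge0// ltW.
  lra.
have := gm (expR (- L)) r0 (expR_gt0 _) (ltW L1) _.
rewrite {2}/r0; have -> : d / 2 < d by lra.
move=> /(_ isT); apply/negP; rewrite -ltNge.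
rewrite {2}/g expRK mulrN opprK.
have Ld : 0 < expR (- L) < d by rewrite expR_gt0 (lt_trans L1)// /r0; lra.
have h : 0 <= rpow m (expR (- L)) * (F (expR (- L)) + 2 * K).
  rewrite mulr_ge0 ?expR_ge0//.
  by have := FK _ Ld; rewrite ler_norml => /andP[Fr _]; lra.
have h2 : `|g r0| < c * L.
  rewrite /L mulrDr mulrDr mulrCA divff ?gt_eqF// !mulr1.
  have : 0 <= c * `|ln r0| by rewrite mulr_ge0// ltW.
  lra.
have := ler_norm (g r0); lra.
Qed.

(* The bounded solutions of (r d_r)^2 F = m^2 F are multiples of r^m: the
   quantity (F1 - m F) r^m, with F1 = r F', is a constant, which vanishes as
   otherwise F would be unbounded at 0. *)
Lemma euler_equation_bounded (F F1 : R -> R) (m K d : R) : 0 <= m -> 0 < d ->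
  (forall r : R, 0 < r < 1 -> is_derive r 1 F (F1 r / r)) ->
  (forall r : R, 0 < r < 1 -> is_derive r 1 F1 (m ^+ 2 * F r / r)) ->
  (forall r, 0 < r < d -> `|F r| <= K) ->
  forall r, 0 < r < 1 -> F1 r = m * F r.
Proof.
move=> m0 d0 dF dF1 FK.
pose W r := (F1 r - m * F r) * rpow m r.
have dW (r : R) : 0 < r < 1 -> is_derive r 1 W 0.
  move=> r1; have /andP[r0 _] := r1; have rn0 : r != 0 by rewrite gt_eqF.
  have h1 := is_derive_sub (dF1 r r1) (is_derive_mulc m (dF r r1)).
  have h2 := is_derive_mul h1 (is_derive_rpow m r0).
  have -> : (0 : R) = (F1 r - m * F r) * (m / r * rpow m r) + rpow m r * (m ^+ 2 * F r / r - m *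
    (F1 r / r)).
    by field.
  exact: h2.
have Wc := is_derive_cst_itv dW.
move=> r rr; apply/eqP; rewrite -subr_eq0; apply/negPn/negP => n0.
pose c := W r; pose d' := Num.min d 1.
have d'0 : 0 < d' by rewrite lt_min d0 ltr01.
have d'1 x : 0 < x < d' -> 0 < x < 1 by rewrite lt_min => /andP[-> /andP[_ ->]].
have d'd x : 0 < x < d' -> 0 < x < d by rewrite lt_min => /andP[-> /andP[-> _]].
have cn0 : c != 0 by rewrite /c /W mulf_neq0// gt_eqF// expR_gt0.
have [c0|c0|c0] := ltgtP c 0; last by rewrite c0 eqxx in cn0.
- apply: (@euler_singular_unbounded (fun x => - F x) (fun x => - F1 x) m (- c) K d') => //.
  + by rewrite oppr_gt0.
  + by move=> x xd; rewrite mulNr; apply: is_derive_opp; exact/dF/d'1.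
  + by move=> x xd; rewrite /c (Wc r x)// ?d'1// /W mulrN -opprD mulNr.
  + by move=> x xd; rewrite normrN FK// d'd.
- apply: (@euler_singular_unbounded F F1 m c K d') => //.
  + by move=> x xd; exact/dF/d'1.
  + by move=> x xd; rewrite /c (Wc r x)// d'1.
  + by move=> x xd; rewrite FK// d'd.
Qed.

End euler_equation.

(** * The vector fields r d_r and d_theta *)

Section polar_calculus.
Context {R : realType}.
Implicit Types (f g h : R * R -> R) (p q : R * R) (r s theta : R).
Let mu := @lebesgue_measure R.
Let C := @circle R.
Let U := @punctured_disk R.

(** This field is r d_r and the next one is d_theta; in Cartesian form their coefficients are
    polynomials, and they can be iterated without division. *)
Definition radial_field f p : R := p.1 * grad_x f p + p.2 * grad_y f p.
Definition angular_field f p : R := - p.2 * grad_x f p + p.1 * grad_y f p.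
Definition pt r theta : R * R := (r * cos theta, r * sin theta).

Definition C2_real f := forall p, U p ->
  [/\ differentiable f p, differentiable (grad_x f) p, differentiable (grad_y f) p,
      {for p, continuous (grad_x (grad_x f))} /\ {for p, continuous (grad_y (grad_x f))} &
      {for p, continuous (grad_x (grad_y f))} /\ {for p, continuous (grad_y (grad_y f))}].

Lemma pt_punctured_disk r theta : 0 < r < 1 -> U (pt r theta).
Proof.
move=> /andP[r0 r1]; have e : (pt r theta).1 ^+ 2 + (pt r theta).2 ^+ 2 = r ^+ 2.
  exact: sqr_radius_polar.
by rewrite /U /punctured_disk /= e exprn_gt0//= expr_lt1// ltW.
Qed.

Lemma near_punctured_disk p : U p -> \forall q \near p, U q.
Proof.
move=> /andP[p0 p1].
have [d _ _] := has_grad_sqr_radius p; have c := differentiable_continuous d.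
have h0 : \forall q \near p, 0 < sqr_radius q by exact: (cvgr_gt _ c).
have h1 : \forall q \near p, sqr_radius q < 1 by exact: (cvgr_lt _ c).
by apply: filterS2 h0 h1 => q q0 q1; apply/andP.
Qed.

Lemma has_grad_radial_field f p : C2_real f -> U p -> has_grad (radial_field f) p
  (grad_x f p + p.1 * grad_x (grad_x f) p + p.2 * grad_x (grad_y f) p)
  (grad_y f p + p.1 * grad_y (grad_x f) p + p.2 * grad_y (grad_y f) p).
Proof.
move=> hf pU; have [d dx dy _ _] := hf p pU.
have hx : has_grad (grad_x f) p (grad_x (grad_x f) p) (grad_y (grad_x f) p)
  := differentiable_has_grad dx.
have hy : has_grad (grad_y f) p (grad_x (grad_y f) p) (grad_y (grad_y f) p)
  := differentiable_has_grad dy.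
have H := has_gradD (has_gradM (has_grad_fst p) hx) (has_gradM (has_grad_snd p) hy).
apply: (has_grad_eq (f := radial_field f) H).
  by move: (grad_x f p) (grad_y f p) (grad_x (grad_x f) p) (grad_x (grad_y f) p) => /= *; ring.
by move: (grad_x f p) (grad_y f p) (grad_y (grad_x f) p) (grad_y (grad_y f) p) => /= *; ring.
Qed.

Lemma has_grad_angular_field f p : C2_real f -> U p -> has_grad (angular_field f) p
  (grad_y f p + - p.2 * grad_x (grad_x f) p + p.1 * grad_x (grad_y f) p)
  (- grad_x f p + - p.2 * grad_y (grad_x f) p + p.1 * grad_y (grad_y f) p).
Proof.
move=> hf pU; have [d dx dy _ _] := hf p pU.
have hx : has_grad (grad_x f) p (grad_x (grad_x f) p) (grad_y (grad_x f) p)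
  := differentiable_has_grad dx.
have hy : has_grad (grad_y f) p (grad_x (grad_y f) p) (grad_y (grad_y f) p)
  := differentiable_has_grad dy.
have H := has_gradD (has_gradM (has_gradN (has_grad_snd p)) hx)
  (has_gradM (has_grad_fst p) hy).
apply: (has_grad_eq (f := angular_field f) H).
  by move: (grad_x f p) (grad_y f p) (grad_x (grad_x f) p) (grad_x (grad_y f) p) => /= *; ring.
by move: (grad_x f p) (grad_y f p) (grad_y (grad_x f) p) (grad_y (grad_y f) p) => /= *; ring.
Qed.

Lemma radial_field2E f p : C2_real f -> U p -> radial_field (radial_field f) p =
  p.1 * (grad_x f p + p.1 * grad_x (grad_x f) p + p.2 * grad_x (grad_y f) p) +
  p.2 * (grad_y f p + p.1 * grad_y (grad_x f) p + p.2 * grad_y (grad_y f) p).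
Proof.
by move=> hf pU; have [_ hx hy] := has_grad_radial_field hf pU;
  rewrite {1}/radial_field /grad_x /grad_y hx hy.
Qed.

Lemma angular_field2E f p : C2_real f -> U p -> angular_field (angular_field f) p =
  - p.2 * (grad_y f p + - p.2 * grad_x (grad_x f) p + p.1 * grad_x (grad_y f) p) +
  p.1 * (- grad_x f p + - p.2 * grad_y (grad_x f) p + p.1 * grad_y (grad_y f) p).
Proof.
by move=> hf pU; have [_ hx hy] := has_grad_angular_field hf pU;
  rewrite {1}/angular_field /grad_x /grad_y hx hy.
Qed.

(* The mixed derivatives in either order cancel out separately. *)
Lemma radial_angular_laplacian f p : C2_real f -> U p ->
  radial_field (radial_field f) p + angular_field (angular_field f) p =
  sqr_radius p * (grad_x (grad_x f) p + grad_y (grad_y f) p).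
Proof.
move=> hf pU; rewrite radial_field2E// angular_field2E// /sqr_radius.
move: (grad_x f p) (grad_y f p) (grad_x (grad_x f) p) (grad_x (grad_y f) p)
  (grad_y (grad_x f) p) (grad_y (grad_y f) p) => *; ring.
Qed.

Section continuity.
Context {T : topologicalType}.
Implicit Types (u v : T -> R) (x : T).

Lemma continuous_at_mul u v x : {for x, continuous u} -> {for x, continuous v} ->
  {for x, continuous (fun y => u y * v y)}.
Proof. by move=> cu cv; exact: cvgM cu cv. Qed.

Lemma continuous_at_add u v x : {for x, continuous u} -> {for x, continuous v} ->
  {for x, continuous (fun y => u y + v y)}.
Proof. by move=> cu cv; exact: cvgD cu cv. Qed.

Lemma continuous_at_opp u x : {for x, continuous u} -> {for x, continuous (fun y => - u y)}.
Proof. by move=> cu; exact: cvgN cu. Qed.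

Lemma continuous_at_near u v x : (\forall y \near x, u y = v y) ->
  {for x, continuous u} -> {for x, continuous v}.
Proof.
move=> uv cu; rewrite /prop_for /continuous_at -(nbhs_singleton uv).
exact: cvg_trans (near_eq_cvg uv) cu.
Qed.

(** The common shape of [radial_field2E] and [angular_field2E]. *)
Lemma continuous_at_quadratic (a b c d e k l m : T -> R) x :
  {for x, continuous a} -> {for x, continuous b} -> {for x, continuous c} ->
  {for x, continuous d} -> {for x, continuous e} -> {for x, continuous k} ->
  {for x, continuous l} -> {for x, continuous m} ->
  {for x, continuous (fun y => a y * (c y + a y * e y + b y * k y) +
                               b y * (d y + a y * l y + b y * m y))}.
Proof.
by move=> *; do ?[apply: continuous_at_add|apply: continuous_at_mul].
Qed.

End continuity.

Lemma C2_real_continuous f p : C2_real f -> U p ->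
  [/\ {for p, continuous (radial_field f)}, {for p, continuous (angular_field f)},
      {for p, continuous (radial_field (radial_field f))} & {for p,
        continuous (angular_field (angular_field f))}].
Proof.
move=> hf pU; have [d dx dy [cxx cyx] [cxy cyy]] := hf p pU.
have cx := differentiable_continuous dx; have cy := differentiable_continuous dy.
have c1 : {for p, continuous (fst : R * R -> R)} by exact: continuous_fstR.
have c2 : {for p, continuous (snd : R * R -> R)} by exact: continuous_sndR.
split.
- by have [/differentiable_continuous] := has_grad_radial_field hf pU.
- by have [/differentiable_continuous] := has_grad_angular_field hf pU.
- apply: (@continuous_at_near _ (fun p =>
    p.1 * (grad_x f p + p.1 * grad_x (grad_x f) p + p.2 * grad_x (grad_y f) p) +
    p.2 * (grad_y f p + p.1 * grad_y (grad_x f) p + p.2 * grad_y (grad_y f) p))).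
    by apply: filterS (near_punctured_disk pU) => q qU; rewrite radial_field2E.
  exact: continuous_at_quadratic c1 c2 cx cy cxx cxy cyx cyy.
- apply: (@continuous_at_near _ (fun p =>
    - p.2 * (grad_y f p + - p.2 * grad_x (grad_x f) p + p.1 * grad_x (grad_y f) p) +
    p.1 * (- grad_x f p + - p.2 * grad_y (grad_x f) p + p.1 * grad_y (grad_y f) p))).
    by apply: filterS (near_punctured_disk pU) => q qU; rewrite (angular_field2E hf qU).
  exact: continuous_at_quadratic (continuous_at_opp c2) c1 cy (continuous_at_opp cx) cxx cxy cyx
    cyy.
Qed.

Lemma is_derive_mulr (c r : R) : is_derive r 1 (fun s => s * c) c.
Proof.
have := is_derive_mulc c (is_derive_id r 1); rewrite mulr1.
by congr is_derive; apply/funext => s; rewrite mulrC.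
Qed.

Lemma is_derive_radial f r theta : 0 < r < 1 -> differentiable f (pt r theta) ->
  is_derive r 1 (fun s => f (pt s theta)) (radial_field f (pt r theta) / r).
Proof.
move=> /andP[r0 _] df.
have := is_derive_curve (is_derive_mulr (cos theta) r) (is_derive_mulr (sin theta) r)
  (differentiable_has_grad df).
have -> : radial_field f (pt r theta) / r = cos theta * grad_x f (r * cos theta, r * sin theta) +
    sin theta * grad_y f (r * cos theta, r * sin theta).
  by rewrite /radial_field /pt /=; move: (grad_x _ _) (grad_y _ _) => *; field; rewrite gt_eqF.
exact.
Qed.

Lemma is_derive_angular f r theta : differentiable f (pt r theta) ->
  is_derive theta 1 (fun t => f (pt r t)) (angular_field f (pt r theta)).
Proof.
move=> df.
have := is_derive_curve (is_derive_mulc r (is_derive_cos theta))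
  (is_derive_mulc r (is_derive_sin theta)) (differentiable_has_grad df).
have -> : angular_field f (pt r theta) = r * - sin theta * grad_x f (r * cos theta, r * sin theta) +
    r * cos theta * grad_y f (r * cos theta, r * sin theta).
  by rewrite /angular_field /pt /=; move: (grad_x _ _) (grad_y _ _) => *; ring.
exact.
Qed.

Lemma continuous_pt : continuous (fun q : R * R => pt q.1 q.2).
Proof.
move=> q; have c1 := @continuous_fstR R q.
have c2 := continuous_comp (@continuous_sndR R q) (@continuous_cos R q.2).
have c3 := continuous_comp (@continuous_sndR R q) (@continuous_sin R q.2).
exact: (cvg_pair (continuous_at_mul c1 c2) (continuous_at_mul c1 c3)).
Qed.

Lemma continuous_angular h r : 0 < r < 1 -> (forall p, U p -> {for p, continuous h}) ->
  continuous (fun theta => h (pt r theta)).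
Proof.
move=> r01 ch theta.
apply: (@continuous_comp _ _ _ (fun t : R => pt r t) h); last exact/ch/pt_punctured_disk.
exact: (cvg_pair (continuous_at_mul (cvg_cst r) (@continuous_cos R theta))
  (continuous_at_mul (cvg_cst r) (@continuous_sin R theta))).
Qed.

(** Compactness of the rectangle of polar coordinates. It supplies the constant that dominates the
    integrand when differentiating under the integral sign. *)
Lemma polar_bounded h (u v : R) : 0 < u -> v < 1 -> (forall p, U p -> {for p, continuous h}) ->
  exists M, forall s theta, u <= s <= v -> C theta -> `|h (pt s theta)| <= M.
Proof.
move=> u0 v1 ch; have [uv|vu] := leP u v; last first.
  exists 0 => s theta /andP[us sv]; have := le_trans us sv.
  by rewrite leNgt vu.
have cK : compact (`[u, v] `*` `[0, 2 * pi] : set (R * R)).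
  by apply: compact_setX; exact: segment_compact.
have [||c _ hc] := @compact_EVT_max _ _ (fun q => `|h (pt q.1 q.2)|) _ _ cK.
- exists (u, 0); split; rewrite /= in_itv /= lexx//=; exact: ltW twopi_gt0.
- apply: continuous_in_subspaceT => q /set_mem [/= q1 q2].
  have qU : U (pt q.1 q.2).
    apply: pt_punctured_disk; move: q1; rewrite in_itv /= => /andP[uq qv].
    by rewrite (lt_le_trans u0)//= (le_lt_trans qv).
  apply: continuous_comp; last exact: norm_continuous.
  by apply: continuous_comp; [exact: continuous_pt|exact: ch].
- exists `|h (pt c.1 c.2)| => s theta sv Ct.
  by apply: (hc (s, theta)); apply/mem_set; split.
Qed.

End polar_calculus.

(** * The differential equation of an angular mode *)

Section angular_modes.
Context {R : realType}.
Implicit Types (f g h : R * R -> R) (p q : R * R) (r s theta : R) (al be : R -> R).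
Let mu := @lebesgue_measure R.
Let C := @circle R.
Let U := @punctured_disk R.

Definition polar_integral f g al be r : R :=
  Rintegral mu C (fun theta => f (pt r theta) * al theta + g (pt r theta) * be theta).

Lemma is_derive_circle_integral (P Q : R -> R -> R) (M u v r : R) : u < r < v ->
  (forall s theta, u < s < v -> is_derive s 1 (P^~ theta) (Q s theta)) ->
  (forall s, u < s < v -> continuous (P s)) ->
  (forall s theta, u < s < v -> C theta -> `|Q s theta| <= M) ->
  is_derive r 1 (fun s => Rintegral mu C (P s)) (Rintegral mu C (Q r)).
Proof.
move=> urv dP cP QM.
have Ir : `]u, v[%classic r by rewrite /= in_itv.
have inI s : `]u, v[%classic s -> u < s < v by rewrite /= in_itv.
have intP s : `]u, v[%classic s -> mu.-integrable C (EFin \o P s).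
  by move=> /inI sI; apply: continuous_integrable_circle; exact: cP.
have derP s theta : `]u, v[%classic s -> C theta -> derivable (P ^~ theta) s 1.
  by move=> /inI sI _; have [] := dP s theta sI.
have d1 s theta : u < s < v -> partial1of2 P s theta = Q s theta.
  by move=> sI; rewrite partial1of2E; have [] := dP s theta sI.
have M0 : 0 <= M.
  have C0 : C 0 by rewrite /C /circle /= in_itv /= lexx /= ltW// twopi_gt0.
  exact: le_trans (QM r 0 urv C0).
have intM : mu.-integrable C (EFin \o cst M).
  by apply: (integrable_bounded (M := M)) => // x _; rewrite /= ger0_norm.
have PM s theta : `]u, v[%classic s -> C theta -> `|partial1of2 P s theta| <= cst M theta.
  by move=> /inI sI Ct; rewrite d1// QM.
split.
  exact: (derivable_under_integral measurable_circleR Ir intP derP (fun=> M0) intM PM).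
rewrite -derive1E.
rewrite (differentiation_under_integral measurable_circleR Ir intP derP (fun=> M0) intM PM).
by apply: eq_Rintegral => theta _; rewrite d1.
Qed.

Lemma is_derive_polar_integral f g al be r :
  (forall p, U p -> differentiable f p) -> (forall p, U p ->
    {for p, continuous (radial_field f)}) ->
  (forall p, U p -> differentiable g p) -> (forall p, U p ->
    {for p, continuous (radial_field g)}) ->
  continuous al -> continuous be -> 0 < r < 1 ->
  is_derive r 1 (polar_integral f g al be) (polar_integral (radial_field f) (radial_field g) al
    be r / r).
Proof.
move=> df cf dg cg cal cbe /andP[r0 r1].
(* Bounds are available only away from radii 0 and 1, hence a neighbourhood of r with u > 0 and v <
   1. *)
pose u := r / 2; pose v := (1 + r) / 2.
have urv : u < r < v by rewrite /u /v; apply/andP; split; lra.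
have u0 : 0 < u by rewrite /u divr_gt0.
have v1 : v < 1 by rewrite /v; lra.
have sub s : u < s < v -> 0 < s < 1.
  by move=> /andP[us sv]; rewrite (lt_trans u0)//= (lt_trans sv).
pose Q s theta := s^-1 * (radial_field f (pt s theta) * al theta + radial_field g (pt s theta) *
  be theta).
have [M1 hM1] := polar_bounded u0 v1 cf.
have [M2 hM2] := polar_bounded u0 v1 cg.
have [A hA] := continuous_circle_bounded cal.
have [B hB] := continuous_circle_bounded cbe.
have H : is_derive r 1 (polar_integral f g al be) (Rintegral mu C (Q r)).
  apply: (@is_derive_circle_integral _ Q (u^-1 * (M1 * A + M2 * B)) u v r urv).
  - move=> s theta /sub s01; have s0 : 0 < s by case/andP: s01.
    have h1 := is_derive_radial s01 (df _ (pt_punctured_disk theta s01)).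
    have h2 := is_derive_radial s01 (dg _ (pt_punctured_disk theta s01)).
    have h3 := is_derive_add (is_derive_mulc (al theta) h1) (is_derive_mulc (be theta) h2).
    have -> : Q s theta = al theta * (radial_field f (pt s theta) / s) + be theta * (radial_field
      g (pt s theta) / s).
      by rewrite /Q; move: (radial_field f _) (radial_field g _) => *; ring.
    have e : (fun s => f (pt s theta) * al theta + g (pt s theta) * be theta) =
        (fun s => al theta * f (pt s theta) + be theta * g (pt s theta)).
      by apply/funext => t; rewrite mulrC; congr (_ + _); exact: mulrC.
    by rewrite e.
  - move=> s /sub s01 theta.
    have c1 := continuous_angular s01 (fun p pU => differentiable_continuous (df p pU)).
    have c2 := continuous_angular s01 (fun p pU => differentiable_continuous (dg p pU)).
    exact: (continuous_at_add (continuous_at_mul (c1 theta) (cal theta))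
      (continuous_at_mul (c2 theta) (cbe theta))).
  - move=> s theta sI Ct; have /andP[us sv] := sI.
    have s0 : 0 < s := lt_trans u0 us.
    have sI' : u <= s <= v by rewrite !ltW.
    rewrite /Q normrM; apply: ler_pM => //.
      by rewrite gtr0_norm ?invr_gt0// lef_pV2 ?posrE// ltW.
    apply: le_trans (ler_normD _ _) _; apply: lerD; rewrite normrM; apply: ler_pM => //.
    + exact: hM1.
    + exact: hA.
    + exact: hM2.
    + exact: hB.
have -> : polar_integral (radial_field f) (radial_field g) al be r / r = Rintegral mu C (Q r).
  have r01 : 0 < r < 1 by rewrite r0.
  have cc : continuous (fun theta => radial_field f (pt r theta) * al theta + radial_field g (pt
    r theta) * be theta).
    have c1 := continuous_angular r01 cf; have c2 := continuous_angular r01 cg.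
    move=> theta.
    exact: (continuous_at_add (continuous_at_mul (c1 theta) (cal theta))
      (continuous_at_mul (c2 theta) (cbe theta))).
  exact: (etrans (mulrC _ _) (esym (Rint_circleZ r^-1 (continuous_integrable_circle cc)))).
exact: H.
Qed.

(* One real component of the k-th angular mode: [al] and [be] are cos and sin
   for the real part, -sin and cos for the imaginary part. *)
Lemma polar_integral_mode (a b : R * R -> R) al be (k nu K d : R) :
  C2_real a -> C2_real b ->
  (forall p, U p -> sqr_radius p * (grad_x (grad_x a) p + grad_y (grad_y a) p) =
     - 2 * nu * angular_field b p + nu ^+ 2 * a p) ->
  (forall p, U p -> sqr_radius p * (grad_x (grad_x b) p + grad_y (grad_y b) p) =
     2 * nu * angular_field a p + nu ^+ 2 * b p) ->
  (forall theta : R, is_derive theta 1 al (- k * be theta)) ->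
  (forall theta : R, is_derive theta 1 be (k * al theta)) ->
  al (2 * pi) = al 0 -> be (2 * pi) = be 0 ->
  0 < d -> (forall r, 0 < r < d -> `|polar_integral a b al be r| <= K) ->
  forall r, 0 < r < 1 ->
  polar_integral (radial_field a) (radial_field b) al be r = `|k - nu| * polar_integral a b al be r.
Proof.
move=> ha hb pa pb dal dbe al2 be2 d0 bnd.
have cal := is_derive1_continuous dal; have cbe := is_derive1_continuous dbe.
have da p : U p -> differentiable a p by move=> pU; have [] := ha p pU.
have db p : U p -> differentiable b p by move=> pU; have [] := hb p pU.
have cEa p : U p -> {for p, continuous (radial_field a)} by move=> pU;
  have [] := C2_real_continuous ha pU.
have cEb p : U p -> {for p, continuous (radial_field b)} by move=> pU;
  have [] := C2_real_continuous hb pU.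
have cEEa p : U p -> {for p, continuous (radial_field (radial_field a))} by move=> pU;
  have [] := C2_real_continuous ha pU.
have cEEb p : U p -> {for p, continuous (radial_field (radial_field b))} by move=> pU;
  have [] := C2_real_continuous hb pU.
have dEa p : U p -> differentiable (radial_field a) p by move=> pU;
  have [] := has_grad_radial_field ha pU.
have dEb p : U p -> differentiable (radial_field b) p by move=> pU;
  have [] := has_grad_radial_field hb pU.
have dTa p : U p -> differentiable (angular_field a) p by move=> pU;
  have [] := has_grad_angular_field ha pU.
have dTb p : U p -> differentiable (angular_field b) p by move=> pU;
  have [] := has_grad_angular_field hb pU.
have EEa p : U p -> radial_field (radial_field a) p = - angular_field (angular_field a) p - 2 *
  nu * angular_field b p + nu ^+ 2 * a p.
  move=> pU; have := radial_angular_laplacian ha pU; rewrite pa//.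
  move: (radial_field _ _) (angular_field (angular_field a) p) (angular_field b p) (a p) => w x y
    z e; lra.
have EEb p : U p -> radial_field (radial_field b) p = - angular_field (angular_field b) p + 2 *
  nu * angular_field a p + nu ^+ 2 * b p.
  move=> pU; have := radial_angular_laplacian hb pU; rewrite pb//.
  move: (radial_field _ _) (angular_field (angular_field b) p) (angular_field a p) (b p) => w x y
    z e; lra.
have key r : 0 < r < 1 -> polar_integral (radial_field (radial_field a)) (radial_field
  (radial_field b)) al be r =
    `|k - nu| ^+ 2 * polar_integral a b al be r.
  move=> r01; have inU theta := pt_punctured_disk theta r01.
  (* The boundary terms of the integrations by parts: the derivative of [G] is the integrand of (r
     d_r)^2 F - (k - nu)^2 F, and [G] takes the same value at 0 and 2 pi. *)
  pose G theta := - (angular_field a (pt r theta) * al theta + angular_field b (pt r theta) * be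
    theta) +
    (k - 2 * nu) * (b (pt r theta) * al theta - a (pt r theta) * be theta).
  pose dG theta := (radial_field (radial_field a) (pt r theta) * al theta + radial_field
    (radial_field b) (pt r theta) * be theta) -
    (k - nu) ^+ 2 * (a (pt r theta) * al theta + b (pt r theta) * be theta).
  have hG (theta : R) : is_derive theta 1 G (dG theta).
    have h1 := is_derive_angular (da _ (inU theta)).
    have h2 := is_derive_angular (db _ (inU theta)).
    have h3 := is_derive_angular (dTa _ (inU theta)).
    have h4 := is_derive_angular (dTb _ (inU theta)).
    have h := is_derive_add
      (is_derive_opp (is_derive_add (is_derive_mul h3 (dal theta)) (is_derive_mul h4 (dbe theta))))
      (is_derive_mulc (k - 2 * nu) (is_derive_sub (is_derive_mul h2 (dal theta)) (is_derive_mul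
        h1 (dbe theta)))).
    have -> : dG theta = - (angular_field a (pt r theta) * (- k * be theta) + al theta *
      angular_field (angular_field a) (pt r theta) +
      (angular_field b (pt r theta) * (k * al theta) + be theta * angular_field (angular_field b)
        (pt r theta))) +
      (k - 2 * nu) * (b (pt r theta) * (- k * be theta) + al theta * angular_field b (pt r theta) -
        (a (pt r theta) * (k * al theta) + be theta * angular_field a (pt r theta))).
      rewrite /dG (EEa _ (inU theta)) (EEb _ (inU theta)).
      move: (angular_field (angular_field a) _) (angular_field (angular_field b) _)
        (angular_field a _) (angular_field b _) (a _) (b _) (al _) (be _) => *.
      by ring.
    exact: h.
  have ca : continuous (fun theta => a (pt r theta)).
    exact: (continuous_angular r01 (fun p pU => differentiable_continuous (da p pU))).
  have cb : continuous (fun theta => b (pt r theta)).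
    exact: (continuous_angular r01 (fun p pU => differentiable_continuous (db p pU))).
  have cea : continuous (fun theta => radial_field (radial_field a) (pt r theta))
    := continuous_angular r01 cEEa.
  have ceb : continuous (fun theta => radial_field (radial_field b) (pt r theta))
    := continuous_angular r01 cEEb.
  have c1 : continuous (fun theta => a (pt r theta) * al theta + b (pt r theta) * be theta).
    move=> t; exact: (continuous_at_add (continuous_at_mul (ca t) (cal t)) (continuous_at_mul (cb
      t) (cbe t))).
  have c2 : continuous (fun theta => radial_field (radial_field a) (pt r theta) * al theta +
    radial_field (radial_field b) (pt r theta) * be theta).
    move=> t; exact: (continuous_at_add (continuous_at_mul (cea t) (cal t)) (continuous_at_mul
      (ceb t) (cbe t))).
  have c3 : continuous (fun theta => (k - nu) ^+ 2 * (a (pt r theta) * al theta + b (pt r theta)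
    * be theta)).
    move=> t; exact: (continuous_at_mul (cvg_cst _) (c1 t)).
  have cdG : continuous dG.
    move=> t; exact: (continuous_at_add (c2 t) (continuous_at_opp (c3 t))).
  have := FTC_circle hG cdG.
  have -> : G (2 * pi) - G 0 = 0.
    have e : pt r (2 * pi) = pt r 0.
      rewrite /pt; have := @cis_int2pi R 1; rewrite mul1r => -[-> ->].
      by rewrite cos0 sin0.
    by rewrite /G e al2 be2 subrr.
  rewrite /dG (Rint_circleB (continuous_integrable_circle c2) (continuous_integrable_circle c3)).
  rewrite (Rint_circleZ _ (continuous_integrable_circle c1)).
  rewrite -real_normK ?num_real// => /eqP; rewrite subr_eq0 => /eqP.
  exact.
apply: (euler_equation_bounded (normr_ge0 _) d0 _ _ bnd).
- move=> r r01; exact: (is_derive_polar_integral da cEa db cEb cal cbe r01).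
- move=> r r01; rewrite -(key r r01).
  exact: (is_derive_polar_integral dEa cEEa dEb cEEb cal cbe r01).
Qed.

End angular_modes.

(** * Fourier coefficients of the boundary values *)

Section DtN_modes.
Context {R : realType}.
Implicit Types (p : R * R) (r s theta nu : R) (k : int).
Let mu := @lebesgue_measure R.
Let C := @circle R.
Let U := @punctured_disk R.

(** Bessel's inequality for the single vector [fourier k] bounds the coefficient of the difference
    by its norm. *)
Lemma cvg_dotL2 (h : R -> R -> R[i]) (Psi : R -> R[i]) k :
  (forall r, 0 < r < 1 -> in_L2 (h r)) -> in_L2 Psi ->
  sqnormL2 (fun theta => h r theta - Psi theta) @[r --> (1 : R)^'-] --> 0%E ->
  complex.Re (dotL2 (h r) (fourier k)) @[r --> (1 : R)^'-] --> complex.Re (dotL2 Psi (fourier k)) /\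
  complex.Im (dotL2 (h r) (fourier k)) @[r --> (1 : R)^'-] --> complex.Im (dotL2 Psi (fourier k)).
Proof.
move=> hL2 PL2 /fine_cvgP[_ lim].
have r01 : \forall r \near (1 : R)^'-, 0 < r < 1.
  have h1 : \forall r \near (1 : R)^'-, 0 < r by exact: nbhs_left_gt.
  have h2 : \forall r \near (1 : R)^'-, r < 1 by exact: nbhs_left_lt.
  by apply: filterS2 h1 h2 => r -> ->.
have H e : 0 < e -> \forall r \near (1 : R)^'-,
    sqmod (dotL2 Psi (fourier k) - dotL2 (h r) (fourier k)) < e ^+ 2.
  move=> e0; have e2 : 0 < e ^+ 2 by exact: exprn_gt0.
  move/cvgr0Pnorm_lt/(_ _ e2) : lim => lim; apply: filterS2 r01 lim => r r1 /= lt.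
  have hr := hL2 r r1; have hd := in_L2B hr PL2; have fk := @fourier_in_L2 R k.
  rewrite (sqnormL2E hd) /= ger0_norm ?nrm2_ge0// in lt; apply: le_lt_trans lt.
  have := bessel (@fourier_in_L2 R) (@dotL2_fourier R) (s := [:: k]) hd isT.
  rewrite big_seq1 dotL2Bl//; apply: le_trans.
  rewrite -opprB; case: (_ - _) => x y; rewrite /sqmod /=; lra.
by split; apply/cvgrPdist_lt => e e0; apply: filterS (H e e0) => r;
  case: (dotL2 Psi _) (dotL2 (h r) _) => [x y] [x' y'] /=; rewrite /sqmod /= => lt;
  rewrite -(ltr_pXn2r (n := 2))// ?nnegrE ?(ltW e0)// real_normK ?num_real//;
  have := sqr_ge0 (x - x'); have := sqr_ge0 (y - y'); lra.
Qed.

Lemma C2_on_real (v : R * R -> R[i]) : C2_on U v ->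
  C2_real (fun p => complex.Re (v p)) /\ C2_real (fun p => complex.Im (v p)).
Proof.
move=> hv; split=> p pU; have [[d1 d2] [[x1 x2] [y1 y2]] [[a1 a2] [b1 b2]] [[c1 c2] [e1 e2]]] :=
  hv p pU.
  split; [exact: d1|exact: x1|exact: y1|exact: (conj a1 c1)|exact: (conj b1 e1)].
split; [exact: d2|exact: x2|exact: y2|exact: (conj a2 c2)|exact: (conj b2 e2)].
Qed.

Lemma magnetic_laplacian_eq0 nu (v : R * R -> R[i]) p (a := fun q => complex.Re (v q))
  (b := fun q => complex.Im (v q)) : C2_on U v -> U p -> magnetic_laplacian nu v p = 0 ->
  sqr_radius p * (grad_x (grad_x a) p + grad_y (grad_y a) p) =
    - 2 * nu * angular_field b p + nu ^+ 2 * a p /\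
  sqr_radius p * (grad_x (grad_x b) p + grad_y (grad_y b) p) =
    2 * nu * angular_field a p + nu ^+ 2 * b p.
Proof.
move=> hv pU; have [dv [dxv dyv] _ _] := hv p pU.
have p0 : 0 < sqr_radius p by case/andP: pU.
rewrite (magnetic_laplacianE _ p0 dv dxv dyv) => -[].
rewrite -/a -/b -/(a p) -/(b p) /angular_field.
move: (grad_x (grad_x a) p) (grad_y (grad_y a) p) (grad_x (grad_x b) p) (grad_y (grad_y b) p)
  (grad_x a p) (grad_y a p) (grad_x b p) (grad_y b p) (a p) (b p) => axx ayy bxx byy ax ay bx by_
    A B.
move: (sqr_radius p) p0 => rho r0 e1 e2; have rn0 : rho != 0 by rewrite gt_eqF.
split.
  (* Add rho times the component of the equation, which is zero. *)
  transitivity (rho * (axx + ayy) + rho * (- (axx + ayy) + 2 * nu / rho * (p.2 * bx - p.1 * by_)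
    + nu ^+ 2 / rho * A)).
    by rewrite e1 mulr0 addr0.
  by field.
transitivity (rho * (bxx + byy) + rho * (- (bxx + byy) - 2 * nu / rho * (p.2 * ax - p.1 * ay) +
  nu ^+ 2 / rho * B)).
  by rewrite e2 mulr0 addr0.
by field.
Qed.

(** The factor [c] will be 1 for the restriction of v to a circle and 1 / r for its radial
    derivative. *)
Lemma dotL2_cis_polar (f g : R * R -> R) (c r : R) k :
  dotL2 (fun theta => ((c * f (pt r theta)) +i* (c * g (pt r theta)))%C)
    (fun theta => cis (k%:~R * theta)) =
  (Rintegral mu C (fun theta => c * (f (pt r theta) * cos (k%:~R * theta) + g (pt r theta) * sin
    (k%:~R * theta))) +i*
   Rintegral mu C (fun theta => c * (f (pt r theta) * - sin (k%:~R * theta) + g (pt r theta) *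
     cos (k%:~R * theta))))%C.
Proof.
rewrite /dotL2 /integral_circle; apply: complexP => /=;
by apply: eq_Rintegral => theta _; rewrite ?(Re_mul, Im_mul) /=; ring.
Qed.

Lemma dotL2_cis_polar_scale (f g : R * R -> R) (c r : R) k : 0 < r < 1 ->
  (forall p, U p -> {for p, continuous f}) -> (forall p, U p -> {for p, continuous g}) ->
  dotL2 (fun theta => ((c * f (pt r theta)) +i* (c * g (pt r theta)))%C)
    (fun theta => cis (k%:~R * theta)) =
  ((c * polar_integral f g (fun t => cos (k%:~R * t)) (fun t => sin (k%:~R * t)) r) +i*
   (c * polar_integral f g (fun t => - sin (k%:~R * t)) (fun t => cos (k%:~R * t)) r))%C.
Proof.
move=> r01 cf cg; rewrite dotL2_cis_polar /polar_integral.
have c1 := continuous_angular r01 cf; have c2 := continuous_angular r01 cg.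
have cc := @continuous_cos_scale R k%:~R; have cs := @continuous_sin_scale R k%:~R.
have h1 : continuous (fun theta => f (pt r theta) * cos (k%:~R * theta) + g (pt r theta) * sin
  (k%:~R * theta)).
  move=> t; exact: (continuous_at_add (continuous_at_mul (c1 t) (cc t)) (continuous_at_mul (c2 t)
    (cs t))).
have h2 : continuous (fun theta => f (pt r theta) * - sin (k%:~R * theta) + g (pt r theta) * cos
  (k%:~R * theta)).
  move=> t; exact: (continuous_at_add (continuous_at_mul (c1 t) (continuous_at_opp (cs t)))
    (continuous_at_mul (c2 t) (cc t))).
by rewrite (Rint_circleZ _ (continuous_integrable_circle h1)) (Rint_circleZ _
  (continuous_integrable_circle h2)).
Qed.

Lemma in_L2_polar (f g : R * R -> R) (c r : R) : 0 < r < 1 ->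
  (forall p, U p -> {for p, continuous f}) -> (forall p, U p -> {for p, continuous g}) ->
  in_L2 (fun theta => ((c * f (pt r theta)) +i* (c * g (pt r theta)))%C).
Proof.
move=> r01 cf cg; apply/in_L2P; split; apply: rL2Z; apply: continuous_rL2.
  exact: (continuous_angular r01 cf).
exact: (continuous_angular r01 cg).
Qed.

(** On each circle of radius r < 1 the coefficients of d_r v are m / r times those of v, by
    [polar_integral_mode] for the real and imaginary parts; both sides converge as r tends to 1. *)
Lemma DtN_fourier_coef nu (Psi Phi : R -> R[i]) k : DtN nu Psi Phi ->
  dotL2 Phi (fourier k) = ((`|k%:~R - nu| : R)%:C)%C * dotL2 Psi (fourier k).
Proof.
move=> [PsiL2 PhiL2 [v [hv lap bnd limPsi limPhi]]].
set m : R := `|k%:~R - nu|.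
pose a := fun q => complex.Re (v q); pose b := fun q => complex.Im (v q).
have [ha hb] : C2_real a /\ C2_real b := C2_on_real hv.
have pde p (pU : U p) := magnetic_laplacian_eq0 hv pU (lap p pU).
have da p : U p -> differentiable a p by move=> pU; have [] := ha p pU.
have db p : U p -> differentiable b p by move=> pU; have [] := hb p pU.
have ca p (pU : U p) := differentiable_continuous (da p pU).
have cb p (pU : U p) := differentiable_continuous (db p pU).
have cEa p : U p -> {for p, continuous (radial_field a)} by move=> pU;
  have [] := C2_real_continuous ha pU.
have cEb p : U p -> {for p, continuous (radial_field b)} by move=> pU;
  have [] := C2_real_continuous hb pU.
pose ck t : R := cos (k%:~R * t); pose sk t : R := sin (k%:~R * t).
have polE r : polar v r = (fun theta => ((1 * a (pt r theta)) +i* (1 * b (pt r theta)))%C).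
  by apply/funext => theta; rewrite !mul1r /a /b /polar /pt; case: (v _).
have radE r : 0 < r < 1 -> radial_derivative v r =
    (fun theta => ((r^-1 * radial_field a (pt r theta)) +i* (r^-1 * radial_field b (pt r
      theta)))%C).
  move=> r01; apply/funext => theta; rewrite /radial_derivative /cderive.
  have [_ e1] := is_derive_radial r01 (da _ (pt_punctured_disk theta r01)).
  have [_ e2] := is_derive_radial r01 (db _ (pt_punctured_disk theta r01)).
  by rewrite mulrC [r^-1 * radial_field b _]mulrC -e1 -e2.
have polL2 r : 0 < r < 1 -> in_L2 (polar v r).
  by move=> r01; rewrite polE; exact: (in_L2_polar _ r01 ca cb).
have radL2 r : 0 < r < 1 -> in_L2 (radial_derivative v r).
  by move=> r01; rewrite (radE _ r01); exact: (in_L2_polar _ r01 cEa cEb).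
have [C0 [d /= d0 bndC]] := bnd k.
pose d' := Num.min d 1; have d'0 : 0 < d' by rewrite lt_min d0 ltr01.
(* The factor (2 pi)^2 removes the normalization of [angular_mode], and |z| <= 1 + z^2 turns a bound
   on squares into a bound on absolute values. *)
pose K := 1 + (2 * pi) ^+ 2 * C0.
have bound r : 0 < r < d' ->
    `|polar_integral a b ck sk r| <= K /\ `|polar_integral a b (fun t => - sk t) ck r| <= K.
  rewrite lt_min => /andP[r0 /andP[rd r1]]; have r01 : 0 < r < 1 by rewrite r0.
  have : sqmod (angular_mode v k r) <= C0.
    by apply: bndC => //; rewrite /ball_ /= sub0r normrN gtr0_norm.
  have -> : angular_mode v k r = (((2 * pi)^-1)%:C)%C * dotL2 (polar v r) (fun theta => cis
    (k%:~R * theta)).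
    by [].
  rewrite sqmodM sqmod_real polE (dotL2_cis_polar_scale _ _ r01 ca cb) !mul1r -/ck -/sk.
  rewrite exprVn mulrC ler_pdivrMr ?exprn_gt0 ?twopi_gt0// mulrC /sqmod /=.
  move: (polar_integral a b ck sk r) (polar_integral a b _ ck r) => x y xy.
  have X (z : R) : `|z| <= 1 + z ^+ 2.
    by rewrite ler_norml; apply/andP; split; nra.
  have := X x; have := X y; have := sqr_ge0 x; have := sqr_ge0 y.
  by rewrite /K; split; lra.
have dck (t : R) : is_derive t 1 ck (- k%:~R * sk t).
  by rewrite mulrC mulrN -mulNr; exact: is_derive_cos_scale.
have dsk (t : R) : is_derive t 1 sk (k%:~R * ck t).
  by rewrite mulrC; exact: is_derive_sin_scale.
have dnsk (t : R) : is_derive t 1 (fun t => - sk t) (- k%:~R * ck t).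
  by rewrite mulNr; exact: (is_derive_opp (dsk t)).
have dck' (t : R) : is_derive t 1 ck (k%:~R * - sk t).
  by rewrite mulrN -mulNr; exact: dck.
have [ck2 sk2] : ck (2 * pi) = ck 0 /\ sk (2 * pi) = sk 0.
  by rewrite /ck /sk mulr0 cos0 sin0; have [-> ->] := @cis_int2pi R k.
have pde1 p pU := proj1 (pde p pU); have pde2 p pU := proj2 (pde p pU).
have M1 := polar_integral_mode ha hb pde1 pde2 dck dsk ck2 sk2 d'0 (fun r rd => proj1 (bound r rd)).
have nsk2 : - sk (2 * pi) = - sk 0 by rewrite sk2.
have M2 := polar_integral_mode ha hb pde1 pde2 dnsk dck' nsk2 ck2 d'0 (fun r rd => proj2 (bound r
  rd)).
have rel r : 0 < r < 1 -> dotL2 (radial_derivative v r) (fourier k) =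
    ((m / r)%:C)%C * dotL2 (polar v r) (fourier k).
  move=> r01; rewrite (dotL2_fourier_cis _ (radL2 r r01)) (dotL2_fourier_cis _ (polL2 r r01)).
  rewrite (radE _ r01) polE (dotL2_cis_polar_scale _ _ r01 ca cb) (dotL2_cis_polar_scale _ _ r01
    cEa cEb).
  rewrite -/ck -/sk (M1 r r01) (M2 r r01) -/m [RHS]mulrCA; congr (_ * _).
  by apply: complexP; rewrite ?Re_realM ?Im_realM /= mul1r mulrA [r^-1 * m]mulrC ?[m * r^-1 *
    _]mulrA // mulrA.
have [P1 P2] := cvg_dotL2 k polL2 PsiL2 limPsi.
have [Q1 Q2] := cvg_dotL2 k radL2 PhiL2 limPhi.
have r01 : \forall r \near (1 : R)^'-, 0 < r < 1.
  have h1 : \forall r \near (1 : R)^'-, 0 < r by exact: nbhs_left_gt.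
  have h2 : \forall r \near (1 : R)^'-, r < 1 by exact: nbhs_left_lt.
  by apply: filterS2 h1 h2 => r -> ->.
have mr : m / r @[r --> (1 : R)^'-] --> m.
  rewrite -[X in _ --> X]divr1; apply: cvg_at_left_filter.
  by apply: cvgM; [exact: cvg_cst|apply: cvgV => //; exact: oner_neq0].
apply: complexP; rewrite ?Re_realM ?Im_realM.
  have Q1' : complex.Re (dotL2 (radial_derivative v r) (fourier k)) @[r --> (1 : R)^'-]
      --> m * complex.Re (dotL2 Psi (fourier k)).
    apply: cvg_trans (cvgM mr P1); apply: near_eq_cvg; apply: filterS r01 => r r01.
    by rewrite (rel r r01) Re_realM.
  exact: etrans (esym (cvg_lim (@Rhausdorff R) Q1)) (cvg_lim (@Rhausdorff R) Q1').
have Q2' : complex.Im (dotL2 (radial_derivative v r) (fourier k)) @[r --> (1 : R)^'-]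
    --> m * complex.Im (dotL2 Psi (fourier k)).
  apply: cvg_trans (cvgM mr P2); apply: near_eq_cvg; apply: filterS r01 => r r01.
  by rewrite (rel r r01) Im_realM.
exact: etrans (esym (cvg_lim (@Rhausdorff R) Q2)) (cvg_lim (@Rhausdorff R) Q2').
Qed.

End DtN_modes.

(** * Closed form and small-time asymptotics *)

Section closed_form.
Context {R : realType}.
Implicit Types (nu t s y : R).

Lemma esum_geometric (a z : R) : 0 <= a -> 0 <= z < 1 ->
  (\esum_(n in [set: nat]) (a * z ^+ n)%:E = (a / (1 - z))%:E)%E.
Proof.
move=> a0 /andP[z0 z1]; rewrite -nneseries_esumT; last first.
  by move=> n; rewrite lee_fin mulr_ge0// exprn_ge0.
apply: cvg_lim => //.
rewrite (_ : (fun n => _) = EFin \o series (geometric a z)).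
  by apply: cvg_EFin; [exact: nearW|apply: cvg_geometric_series; rewrite ger0_norm].
by apply/funext => n /=; rewrite -sumEFin.
Qed.

(** Since 0 <= nu < 1, |k - nu| is n + nu for k = - n <= 0 and n + 1 - nu for k = n + 1 > 0; both
    series have ratio exp (- t). *)
Lemma esum_heat (nu t : R) : 0 <= nu < 1 -> 0 < t ->
  (\esum_(k in [set: int]) (expR (- (t * `|k%:~R - nu|)))%:E =
   (2 * cosh (t * nu) / (1 - expR (- t)) - expR (t * nu))%:E)%E.
Proof.
move=> /andP[nu0 nu1] t0.
have q1 : 0 <= expR (- t) < 1 by rewrite expR_ge0/= expR_lt1 oppr_lt0.
rewrite (esumID (range (fun n : nat => - n%:Z))); last by move=> k _; rewrite lee_fin expR_ge0.
rewrite setTI setTI.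
have -> : ~` range (fun n : nat => - n%:Z) = range (fun n : nat => n.+1%:Z).
  apply/seteqP; split => [k /= nk|_ [n _ <-] [m _]]; last by case: m => [|m]//=.
  case: k nk => [[|n]|n] nk.
  - by exfalso; apply: nk; exists 0%N.
  - by exists n.
  - by exfalso; apply: nk; exists n.+1 => //; rewrite NegzE.
rewrite !esum_image; last 2 first.
- by move=> m n _ _ [].
- by move=> m n _ _ /oppr_inj [].
have -> : (\esum_(i in [set: nat]) (expR (- (t * `|(- i%:Z)%:~R - nu|)))%:E =
    \esum_(n in [set: nat]) (expR (- (t * nu)) * expR (- t) ^+ n)%:E)%E.
  apply: eq_esum => n _; rewrite -expRM_natl -expRD; congr (expR _)%:E.
  rewrite ler0_norm; last by rewrite mulrNz -pmulrn; have := ler0n R n; lra.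
  by rewrite mulrNz -pmulrn; ring.
have -> : (\esum_(i in [set: nat]) (expR (- (t * `|(i.+1%:Z)%:~R - nu|)))%:E =
    \esum_(n in [set: nat]) ((expR (t * nu) * expR (- t)) * expR (- t) ^+ n)%:E)%E.
  apply: eq_esum => n _; rewrite -mulrA -exprS -expRM_natl -expRD; congr (expR _)%:E.
  rewrite -pmulrn ger0_norm; first by ring.
  by rewrite -[n.+1]addn1 natrD; have := ler0n R n; lra.
rewrite !(esum_geometric _ q1) ?mulr_ge0 ?expR_ge0//.
rewrite -EFinD /cosh; congr EFin; field.
by rewrite subr_eq0 eq_sym lt_eqF//; case/andP: q1.
Qed.

(** Both sides are rational functions of q = exp (t / 2) > 1 and a = exp (t nu). *)
Lemma heat_closed_form (nu t : R) : 0 < t ->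
  2 * cosh (t * nu) / (1 - expR (- t)) - expR (t * nu) =
  cosh (t * (nu - 1 / 2)) / sinh (t / 2).
Proof.
move=> t0; rewrite /cosh /sinh.
have -> : t * (nu - 1 / 2) = t * nu - t / 2 by field.
have -> : - t = - (t / 2) - t / 2 by field.
rewrite opprB !expRD !expRN.
have q1 : 1 < expR (t / 2) by rewrite expR_gt1 divr_gt0.
have a0 : expR (t * nu) != 0 by rewrite gt_eqF ?expR_gt0.
move: (expR (t / 2)) (expR (t * nu)) q1 a0 => q a q1 a0.
have q0 : q != 0 by rewrite gt_eqF//; lra.
have qq : q * q - 1 != 0 by rewrite gt_eqF//; nra.
by field; rewrite q0 qq a0.
Qed.

(** The mean value theorem between 0 and y; the constant [K] is kept, at the cost of the factor 1 /
    (n + 1) that integration would gain. *)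
Lemma taylor_step (F f : R -> R) (K : R) n :
  (forall y : R, is_derive y 1 F (f y)) -> F 0 = 0 -> 0 <= K ->
  (forall y, `|y| <= 1 -> `|f y| <= K * `|y| ^+ n) ->
  forall y, `|y| <= 1 -> `|F y| <= K * `|y| ^+ n.+1.
Proof.
move=> dF F0 K0 fK y y1.
have cF (x : R) : {for x, continuous F}.
  by apply: differentiable_continuous; rewrite -derivable1_diffP; have [] := dF x.
have cW (D : set R) : {within D, continuous F} by exact: continuous_subspaceT.
have step c : `|c| <= `|y| -> `|f c * y| <= K * `|y| ^+ n.+1.
  move=> cy; rewrite normrM exprSr mulrA ler_wpM2r//.
  rewrite (le_trans (fK _ (le_trans cy y1)))// ler_wpM2l//.
  by rewrite lerXn2r ?nnegrE.
have [yl|yg|y0] := ltgtP y 0.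
- have [c] := @MVT _ F f _ _ yl (fun x _ => dF x) (cW _).
  rewrite in_itv /= F0 !sub0r mulrN => /andP[yc c0] /oppr_inj ->.
  by apply: step; rewrite !ltr0_norm//; lra.
- have [c] := @MVT _ F f _ _ yg (fun x _ => dF x) (cW _).
  rewrite in_itv /= F0 !subr0 => /andP[yc c0] ->.
  by apply: step; rewrite !gtr0_norm//; lra.
- by rewrite y0 F0 normr0 expr0n /= mulr0.
Qed.

Lemma is_derive_expRN (y : R) : is_derive y 1 (fun x : R => expR (- x)) (- expR (- y)).
Proof.
rewrite -mulrN1; apply: (is_derive_comp_real (h := expR)).
Qed.

Lemma is_derive_cosh (y : R) : is_derive y 1 (@cosh R) (sinh y).
Proof.
have := is_derive_mulc 2^-1 (is_derive_add (is_derive_expR y) (is_derive_expRN y)).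
rewrite /cosh /sinh mulrC; congr is_derive; apply/funext => x; exact: mulrC.
Qed.

Lemma is_derive_sinh (y : R) : is_derive y 1 (@sinh R) (cosh y).
Proof.
have := is_derive_mulc 2^-1 (is_derive_sub (is_derive_expR y) (is_derive_expRN y)).
rewrite /cosh /sinh mulrC opprK; congr is_derive; apply/funext => x; exact: mulrC.
Qed.

(** Five applications of [taylor_step] from |cosh| <= e on [-1, 1]: the Taylor remainders of cosh
    and sinh are successively derivatives of one another. *)
Lemma cosh_sinh_taylor y : `|y| <= 1 ->
  `|cosh y - 1 - y ^+ 2 / 2| <= expR 1 * `|y| ^+ 4 /\
  `|sinh y - y - y ^+ 3 / 6| <= expR 1 * `|y| ^+ 5.
Proof.
have K0 : 0 <= expR 1 :> R by exact: expR_ge0.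
have c0 z : `|z| <= 1 -> `|@cosh R z| <= expR 1 * `|z| ^+ 0.
  rewrite ler_norml => /andP[z1 z2]; rewrite expr0 mulr1 /cosh ger0_norm; last first.
    by rewrite divr_ge0// addr_ge0// expR_ge0.
  have h1 : expR z <= expR 1 by rewrite ler_expR.
  have h2 : expR (- z) <= expR 1 by rewrite ler_expR; lra.
  lra.
have dX n (z : R) : is_derive z 1 (fun x : R => x ^+ n.+1) (n.+1%:R * z ^+ n).
  by split; [exact: exprn_derivable|rewrite exp_derive; exact: mulr1].
have sh0 : sinh 0 = 0 :> R by rewrite /sinh oppr0 subrr mul0r.
have ch0 : cosh 0 = 1 :> R by rewrite /cosh oppr0 expR0; field.
have d1 (z : R) : is_derive z 1 (fun x => cosh x - 1) (sinh z).
  have H : is_derive z 1 (fun _ : R => 1 : R) 0 by exact: is_derive_cst.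
  by have := is_derive_sub (is_derive_cosh z) H; rewrite subr0.
have d2 (z : R) : is_derive z 1 (fun x => sinh x - x) (cosh z - 1).
  exact: (is_derive_sub (is_derive_sinh z) (is_derive_id z 1)).
have d3 (z : R) : is_derive z 1 (fun x => cosh x - 1 - x ^+ 2 / 2) (sinh z - z).
  have H : is_derive z 1 (fun x : R => x ^+ 2 / 2) z.
    have := is_derive_mulc 2^-1 (dX 1%N z).
    rewrite expr1 mulKf//; congr is_derive; apply/funext => x; exact: mulrC.
  exact: (is_derive_sub (d1 z) H).
have d4 (z : R) : is_derive z 1 (fun x => sinh x - x - x ^+ 3 / 6) (cosh z - 1 - z ^+ 2 / 2).
  have H : is_derive z 1 (fun x : R => x ^+ 3 / 6) (z ^+ 2 / 2).
    have := is_derive_mulc 6^-1 (dX 2%N z).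
    have -> : 6^-1 * (3 * z ^+ 2) = z ^+ 2 / 2 by field.
    congr is_derive; apply/funext => x; exact: mulrC.
  exact: (is_derive_sub (d2 z) H).
have s1 := taylor_step is_derive_sinh sh0 K0 c0.
have s2 := taylor_step d1 _ K0 s1.
have s3 := taylor_step d2 _ K0 (s2 _).
have s4 := taylor_step d3 _ K0 (s3 _ _).
have s5 := taylor_step d4 _ K0 (s4 _ _ _).
by move=> y1; split; [apply: s4|apply: s5]; rewrite ?ch0 ?sh0 ?expr0n ?mul0r ?subrr ?subr0.
Qed.

Lemma heat_asymptotics (nu : R) : 0 <= nu < 1 ->
  (fun t : R => (2 * cosh (t * nu) / (1 - expR (- t)) - expR (t * nu)) -
     (2 / t + (1 / 6 - nu + nu ^+ 2) * t))
    =O_ ((0 : R)^'+) (fun t : R => t ^+ 3).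
Proof.
move=> /andP[nu0 nu1]; apply/eqO_exP.
pose K : R := expR 1.
have K1 : 1 <= K by rewrite -expR0 ler_expR.
(* With s = t / 2, the numerator of the error is at most (3 K + 1) s^4, its denominator is sinh s >=
   s, and s^3 = t^3 / 8. *)
exists ((3 * K + 1) / 8); first by lra.
near=> t.
have t0 : 0 < t by [].
(* Gives K s < 1 / 12, which makes the remainder of sinh s smaller than s^3 / 6, whence sinh s >=
   s. *)
have t1 : t < 1 / (6 * K).
  near: t; apply: nbhs_right_lt; rewrite divr_gt0// mulr_gt0//; lra.
rewrite heat_closed_form//.
pose s := t / 2; pose w := 2 * nu - 1.
have -> : t * (nu - 1 / 2) = w * s by rewrite /w /s; field.
have -> : 2 / t + (1 / 6 - nu + nu ^+ 2) * t = s^-1 + (w ^+ 2 / 2 - 6^-1) * s.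
  by rewrite /w /s; field; rewrite gt_eqF.
have st : t = 2 * s by rewrite /s; field.
rewrite -/s {t0}.
have s0 : 0 < s by rewrite /s divr_gt0.
have sK : K * s < 1 / 12.
  move: t1; rewrite ltr_pdivlMr; last lra.
  rewrite st; lra.
have s1 : s < 1 / 12 by nra.
have w1 : -1 <= w <= 1 by rewrite /w; apply/andP; split; lra.
have s4 : 0 <= s ^+ 4 by exact: exprn_ge0 (ltW s0).
have ws1 : `|w * s| <= 1 by rewrite ler_norml; apply/andP; split; nra.
have [A1 _] := cosh_sinh_taylor ws1.
have s11 : `|s| <= 1 by rewrite ler_norml; apply/andP; split; lra.
have [_ B1] := cosh_sinh_taylor s11.
rewrite (gtr0_norm s0) in B1.
have {}A1 : `|cosh (w * s) - 1 - (w * s) ^+ 2 / 2| <= K * s ^+ 4.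
  apply: (le_trans A1); rewrite ler_wpM2l ?expR_ge0// normrM.
  rewrite exprMn (gtr0_norm s0) ler_piMl// exprn_ile1// ler_norml.
  by apply/andP; split; lra.
set A := cosh (w * s) - 1 - (w * s) ^+ 2 / 2 in A1.
rewrite -/K in B1; set B := sinh s - s - s ^+ 3 / 6 in B1.
pose c := w ^+ 2 / 2 - 6^-1; pose B' := B / s.
have B'1 : `|B'| <= K * s ^+ 4.
  by rewrite normrM normfV (gtr0_norm s0) ler_pdivrMr// -mulrA -exprSr.
have c1 : `|c| <= 1.
  have : 0 <= w ^+ 2 <= 1 by rewrite sqr_ge0/=; nra.
  by rewrite /c ler_norml => /andP[? ?]; apply/andP; split; lra.
(* The value of [c] is the one that cancels the terms in s^2 of the numerator. *)
have eN : cosh (w * s) / sinh s - (s^-1 + c * s) =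
    (A - c / 6 * s ^+ 4 - B' - c * s ^+ 2 * B') / sinh s.
  have S0 : sinh s != 0.
    rewrite gt_eqF// /sinh divr_gt0// subr_gt0 ltr_expR; lra.
  by rewrite /A /B' /B /c; field; rewrite S0 gt_eqF.
have Ss : s <= sinh s.
  have -> : sinh s = s + (s ^+ 3 / 6 + B) by rewrite /B; ring.
  rewrite lerDl.
  have h5 : K * s ^+ 5 <= s ^+ 3 / 6.
    have -> : K * s ^+ 5 = s ^+ 3 * (K * s * s) by ring.
    have : K * s * s <= 1 / 12 * (1 / 12) by apply: ler_pM; rewrite ?mulr_ge0 ?ltW//; lra.
    by move=> h; rewrite ler_wpM2l ?exprn_ge0 ?(ltW s0)//; lra.
  by move: B1; rewrite ler_norml => /andP[? ?]; lra.
rewrite eN normrM normfV (gtr0_norm (lt_le_trans s0 Ss)).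
rewrite ler_pdivrMr; last exact: lt_le_trans Ss.
have -> : `|t ^+ 3| = 8 * s ^+ 3.
  by rewrite normrX gtr0_norm ?st ?mulr_gt0//; ring.
have s3 : 0 <= (3 * K + 1) * s ^+ 3.
  by rewrite mulr_ge0 ?exprn_ge0 ?(ltW s0)//; lra.
have : (3 * K + 1) * s ^+ 3 * s <= (3 * K + 1) * s ^+ 3 * sinh s by rewrite ler_wpM2l.
rewrite (_ : (3 * K + 1) / 8 * (8 * s ^+ 3) * sinh s = (3 * K + 1) * s ^+ 3 * sinh s);
  last by field.
apply: le_trans.
have -> : (3 * K + 1) * s ^+ 3 * s = K * s ^+ 4 + s ^+ 4 + K * s ^+ 4 + K * s ^+ 4 by ring.
apply: (le_trans (ler_normB _ _)); apply: lerD; last first.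
  rewrite normrM; apply: le_trans B'1; rewrite ler_piMl ?normr_ge0//.
  rewrite normrM normrX (gtr0_norm s0) mulr_ile1 ?normr_ge0 ?exprn_ge0 ?(ltW s0)//.
  by rewrite exprn_ile1 ?(ltW s0)//; lra.
apply: (le_trans (ler_normB _ _)); apply: lerD => //.
apply: (le_trans (ler_normB _ _)); apply: lerD => //.
rewrite normrM (ger0_norm s4) ler_piMl// normrM normfV.
by rewrite (gtr0_norm (_ : 0 < 6))// ; lra.
Unshelve. all: end_near. Qed.

End closed_form.

(** * The heat trace of the Dirichlet-to-Neumann operator *)

Section heat_trace_DtN.
Context {R : realType}.
Implicit Types (nu t : R).

Lemma DtN_diagonalizes nu :
  diagonalizes (DtN nu) fourier (fun k => `|k%:~R - nu|).
Proof. by split; [exact: fourier_hilbert_basis|exact: DtN_fourier]. Qed.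

(** Applying [DtN_fourier_coef] to the pair (e_k, lam_k e_k) of the graph gives lam_k <e_k, E_j> =
    |j - nu| <e_k, E_j>, where E_j is [fourier j]. *)
Lemma DtN_eigenvalue nu e lam k j : diagonalizes (DtN nu) e lam ->
  dotL2 (e k) (fourier j) != 0 -> lam k = `|j%:~R - nu|.
Proof.
move=> [[eL2 _ _] eM] n0; have := DtN_fourier_coef j (eM k).
rewrite dotL2Zl//; last exact: fourier_in_L2.
by move=> /(mulIf n0) [].
Qed.

Lemma DtN_heat_trace nu t : 0 <= nu < 1 -> 0 < t ->
  is_heat_trace (DtN nu) t (2 * cosh (t * nu) / (1 - expR (- t)) - expR (t * nu)).
Proof.
move=> nu01 t0; split; first by do 2 eexists; exact: DtN_diagonalizes.
move=> e lam f diag hf; have [he _] := diag.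
rewrite heat_trace_spectral//.
rewrite (esum_eigenvalues (m := fun j => `|j%:~R - nu|)
  (F := fun x => expR (- (t * x))) he fourier_hilbert_basis).
- exact: esum_heat.
- by move=> x; exact: expR_ge0.
- by move=> k j; exact: DtN_eigenvalue diag.
Qed.

End heat_trace_DtN.

Unset Implicit Arguments.

Theorem mainTheorem4 (R : realType) (nu : R) (hnu : 0 <= nu < 1) :
  exists Tr : R -> R,
  [/\ forall t : R, 0 < t -> is_heat_trace (DtN nu) t (Tr t),
      forall t : R, 0 < t ->
        Tr t = 2 * cosh (t * nu) / (1 - expR (- t)) - expR (t * nu) /\
        Tr t = cosh (t * (nu - 1 / 2)) / sinh (t / 2)
    & (fun t : R => Tr t - (2 / t + (1 / 6 - nu + nu ^+ 2) * t))
        =O_ ((0 : R)^'+) (fun t : R => t ^+ 3)].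
Proof.
exists (fun t => 2 * cosh (t * nu) / (1 - expR (- t)) - expR (t * nu)); split.
- by move=> t; exact: DtN_heat_trace.
- by move=> t t0; split => //; exact: heat_closed_form.
- exact: heat_asymptotics.
Qed.
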